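(* Let $T$ be the first passage time of the geometric Brownian motion $Y$ through the constant threshold $S>y_0$, with associated parameters $a>0$ and $b>0$ (as defined in the context). Then for every integer $n\ge 1$, $$\mathbb{E}[T^n]=\left(-\frac{2b^2}{a}\right)^n G_n\!\left(-\frac{a}{b};\ \frac12,\ \left(\frac12\right)_2,\ \ldots,\ \left(\frac12\right)_{n}\right).$$
   Context: Setting: $W$ is a standard Brownian motion, $\sigma>0$, $\mu>\sigma^2/2$, $y_0>0$, and $Y(t)=y_0\,e^{(\mu-\sigma^2/2)t+\sigma W(t)}$, $t\ge 0$, is the geometric Brownian motion. $S$ is a constant with $S>y_0$, and $T=\inf\{t\ge 0: Y(t)>S\}$. Put $$a=\frac{(\ln S-\ln y_0)^2}{\sigma^2}>0,\qquad b=\frac{\ln S-\ln y_0}{\mu-\sigma^2/2}>0 .$$ $T$ has the inverse Gaussian probability density $g(t)=\sqrt{\frac{a}{2\pi t^3}}\exp\left(-\frac{a(t-b)^2}{2b^2t}\right)$, $t>0$. Notation: $(x)_n=\prod_{j=0}^{n-1}(x-j)$ is the lowering (falling) factorial; in particular $(1/2)_1=1/2$. The partition polynomial is $$G_n(y;x_1,\ldots,x_n)=\sum_{j=1}^n y^j B_{n,j}(x_1,\ldots,x_{n-j+1}),$$ where $B_{n,j}$ are the partial exponential Bell polynomials $$B_{n,j}(x_1,\ldots,x_{n-j+1})=\sum\frac{n!}{i_1!\,i_2!\cdots i_{n-j+1}!}\prod_{k=1}^{n-j+1}\left(\frac{x_k}{k!}\right)^{i_k},$$ the sum being over all sequences $i_1,\ldots,i_{n-j+1}$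 of non-negative integers with $i_1+2i_2+\cdots+(n-j+1)i_{n-j+1}=n$ and $i_1+i_2+\cdots+i_{n-j+1}=j$. *)

(* Defs.v *)
From HB Require Import structures.
From mathcomp Require Export all_boot all_order all_algebra.
From mathcomp Require Export all_classical all_reals all_analysis.

Set Implicit Arguments.
Unset Strict Implicit.
Unset Printing Implicit Defensive.

Import Order.TTheory GRing.Theory Num.Theory numFieldNormedType.Exports.

Local Open Scope classical_set_scope.
Local Open Scope ring_scope.

Definition mutually_independent (R : realType) (d : measure_display)
    (Omega : measurableType d) (P : probability Omega R) (n : nat)
    (X : 'I_n -> Omega -> R) : Prop :=
  forall (J : {set 'I_n}) (A : 'I_n -> set R),
    (forall i, measurable (A i)) ->
    P (\bigcap_(i in [set` J]) (X i @^-1` A i)) =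
      (\prod_(i in J) P (X i @^-1` A i))%E.

(* Time is [0, +oo[: no condition mentions W t for t < 0.  The second parameter
   of normal_prob is the standard deviation. *)
Record standard_brownian_motion (R : realType) (d : measure_display)
    (Omega : measurableType d) (P : probability Omega R)
    (W : R -> {RV P >-> R}) : Prop := StandardBrownianMotion {
  sbm_start : {ae P, forall w, W 0 w = 0} ;
  sbm_indep : forall (n : nat) (t : nat -> R), 0 <= t 0%N ->
    {homo t : i j / (i <= j)%N >-> i <= j} ->
    mutually_independent P (fun i : 'I_n => W (t i.+1) \- W (t i)) ;
  sbm_gauss : forall s t : R, 0 <= s -> s < t ->
    forall A : set R, measurable A ->
    pushforward P (W t \- W s) A = normal_prob 0 (Num.sqrt (t - s)) A ;
  sbm_cont : {ae P, forall w, {within `[0, +oo[, continuous (fun t : R => W t w)}}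
}.

Definition geometric_brownian_motion (R : realType) (d : measure_display)
    (Omega : measurableType d) (P : probability Omega R)
    (W : R -> {RV P >-> R}) (mu sigma y0 : R) (t : R) (w : Omega) : R :=
  y0 * expR ((mu - sigma ^+ 2 / 2) * t + sigma * W t w).

(* Extended-real valued: +oo when the path never exceeds S. *)
Definition first_passage_time (R : realType) (Omega : Type)
    (Y : R -> Omega -> R) (S : R) (w : Omega) : \bar R :=
  ereal_inf [set t%:E | t in [set t | 0 <= t /\ S < Y t w]].

Definition falling_factorial (R : nzRingType) (x : R) (n : nat) : R :=
  \prod_(j < n) (x - j%:R).

(* The k-th variable x_k (k >= 1) is x k, so x 0 is unused.  The ordinal k in the
   bounds below stands for k + 1, and i k is the multiplicity of x_(k+1); the
   constraints force every multiplicity to be at most n, so the sum over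
   'I_n.+1-valued sequences omits no term. *)
Definition bell_partial (R : fieldType) (n j : nat) (x : nat -> R) : R :=
  \sum_(i : {ffun 'I_(n - j + 1) -> 'I_n.+1} |
          (\sum_(k < n - j + 1) k.+1 * i k == n)%N &&
          (\sum_(k < n - j + 1) i k == j)%N)
    n`!%:R / (\prod_(k < n - j + 1) (i k)`!%:R) *
    \prod_(k < n - j + 1) (x k.+1 / k.+1`!%:R) ^+ i k.

Definition partition_polynomial (R : fieldType) (n : nat) (y : R)
    (x : nat -> R) : R :=
  \sum_(1 <= j < n.+1) y ^+ j * bell_partial n j x.

(* Main.v *)
Require Import Defs.
From HB Require Import structures.
From mathcomp Require Import measurable_realfun zify ring lra.
Import Order.TTheory GRing.Theory Num.Theory numFieldNormedType.Exports.
Local Open Scope classical_set_scope.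
Local Open Scope ring_scope.
Set Implicit Arguments.
Unset Strict Implicit.
Unset Printing Implicit Defensive.

(* With x = ln S - ln y0 and nu = mu - sigma^2/2, T is the first passage time of
   X_t = nu t + sigma W_t above x.  For al > 0 and lam = al nu + al^2 sigma^2/2,
   optional stopping of exp(al X_t - lam t) gives E[exp(-lam T)] = exp(-al x).
   It is done on the grid of mesh h = 1/(m+1) up to time m+1, where stopping is
   a finite recursion on independent factors.  The martingale is at least
   exp(al x - lam t) at the first crossing time t, and the part of its
   expectation where it exceeds this by a factor r > 1 is O(h) by an
   exponential Markov inequality; let m -> oo, then r -> 1.
   Hence, with c = a/b and q = 2 b^2/a, the Laplace transform of T is
   phi(l) = exp(c - c sqrt(1 + q l)) for l > 0.  The moment E[T^n] is the limit
   at 0 of (-1)^n phi^(n), by differentiation under the integral and monotone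
   convergence, and Faa di Bruno's formula evaluates phi^(n)(0), because the
   k-th derivative of sqrt(1 + q l) at 0 is q^k (1/2)_k. *)

(** * Bell polynomials *)

(* [partition_polynomial 0] is the empty sum, whereas the recurrence and
   Faa di Bruno's formula require the value 1 at 0. *)
Definition bell_polynomial (R : fieldType) (n : nat) (y : R) (x : nat -> R) : R :=
  if n is 0 then 1 else partition_polynomial n y x.

Section bell.
Variables (R : numFieldType) (y : R) (x : nat -> R).

(* Truncated exponentials keep the generating function a polynomial; for
   [n <= N] the truncation does not affect the coefficient of ['X^n]. *)
Definition trunc_exp (N k : nat) : {poly R} :=
  \sum_(m < N.+1) ((y * (x k.+1 / k.+1`!%:R)) ^+ m / m`!%:R) *: 'X^(k.+1 * m).

(** Up to degree [N] this agrees with the exponential series of y sum_{k>=1} x_k X^k / k!, whose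
    coefficient of X^n is G_n / n!, with G_0 = 1. *)
Definition bell_gen (N : nat) : {poly R} := \prod_(k < N) trunc_exp N k.

(** The coefficient of X^k in the derivative of the exponent y sum_{k>=1} x_k X^k / k!. *)
Let zc (k : nat) : R := k.+1%:R * (y * (x k.+1 / k.+1`!%:R)).

(** Formally exp(w X^(k+1)) has logarithmic derivative (k+1) w X^k. Truncation leaves only the top
    term m = N uncancelled, and its degree k + (k+1) N is at least N. *)
Lemma deriv_trunc_exp N k : exists S : {poly R},
  (trunc_exp N k)^`() = (zc k *: 'X^k) * trunc_exp N k + 'X^N * S.
Proof.
set w := y * (x k.+1 / k.+1`!%:R).
have -> : (trunc_exp N k)^`() = (zc k *: 'X^k) *
    \sum_(m < N) (w ^+ m / m`!%:R) *: 'X^(k.+1 * m).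
  rewrite /trunc_exp raddf_sum /= big_ord_recl derivZ derivXn.
  rewrite muln0 mulr0n scaler0 add0r.
  rewrite mulr_sumr; apply: eq_bigr => m _.
  rewrite derivZ derivXn -(scaler_nat _ 'X^_) lift0 -/w.
  rewrite -scalerAl -scalerAr -exprD !scalerA.
  rewrite (_ : (k.+1 * m.+1).-1 = (k + k.+1 * m)%N); last by rewrite mulnS; lia.
  congr (_ *: _).
  rewrite exprS factS !natrM /zc -/w.
  have h1 : m.+1%:R != 0 :> R by rewrite pnatr_eq0.
  have h2 : m`!%:R != 0 :> R by rewrite pnatr_eq0 -lt0n fact_gt0.
  by field; rewrite h2 addrC natr1 h1.
exists (- (zc k *: ((w ^+ N / N`!%:R) *: 'X^(k + k * N)))).
rewrite /trunc_exp [in RHS]big_ord_recr /= -/w mulrDr -addrA.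
rewrite [X in _ + X](_ : _ = 0) ?addr0 //.
rewrite mulrN -!scalerAl -!scalerAr -!exprD.
by rewrite (_ : (k + k.+1 * N = N + (k + k * N))%N) ?subrr//; lia.
Qed.

Lemma deriv_bell_gen N : exists S : {poly R},
  (bell_gen N)^`() = (\sum_(k < N) zc k *: 'X^k) * bell_gen N + 'X^N * S.
Proof.
(* The number [M] of factors varies while the truncation order [N] stays fixed; by the product rule
   the logarithmic derivatives add up. *)
suff: forall M, exists S : {poly R}, (\prod_(k < M) trunc_exp N k)^`() =
    (\sum_(k < M) zc k *: 'X^k) * (\prod_(k < M) trunc_exp N k) + 'X^N * S.
  exact.
elim=> [|M [S IH]].
  by exists 0; rewrite !big_ord0 mul0r mulr0 addr0 derivC.
have [S' HS'] := deriv_trunc_exp N M.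
exists (S * trunc_exp N M + (\prod_(k < M) trunc_exp N k) * S').
rewrite !big_ord_recr /= derivM IH HS'; ring.
Qed.

Lemma coef_bell_gen N n : (n < N)%N ->
  n.+1%:R * (bell_gen N)`_n.+1 = \sum_(k < n.+1) zc k * (bell_gen N)`_(n - k).
Proof.
move=> nN; have [S HS] := deriv_bell_gen N.
have := congr1 (fun p : {poly R} => p`_n) HS.
rewrite coef_deriv coefD coefXnM nN addr0 mulr_natl => ->.
rewrite coefM; apply: eq_bigr => k _; congr (_ * _).
rewrite coef_sum (bigD1 (Ordinal (leq_trans (ltn_ord k) nN))) //=.
rewrite coefZ coefXn eqxx mulr1 big1 ?addr0 // => i ik.
rewrite coefZ coefXn (_ : (k == i :> nat) = false) ?mulr0 //.
by apply/eqP => ki; move/eqP: ik; apply; apply/val_inj.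
Qed.

Lemma bell_gen0 N : (bell_gen N)`_0 = 1.
Proof.
rewrite /bell_gen -horner_coef0 horner_prod big1 // => k _.
rewrite horner_coef0 /trunc_exp coef_sum big_ord_recl coefZ coefXn muln0.
rewrite expr0 fact0 divr1 mulr1 big1 ?addr0 // => i _.
by rewrite coefZ coefXn lift0 eq_sym muln_eq0 /= mulr0.
Qed.

(** The recurrence [coef_bell_gen] and the initial value [bell_gen0] do not involve the truncation
    order. *)
Lemma bell_gen_stable N M n : (n <= N)%N -> (n <= M)%N ->
  (bell_gen N)`_n = (bell_gen M)`_n.
Proof.
elim/ltn_ind: n => -[|n] IH nN nM; first by rewrite !bell_gen0.
have n0 : n.+1%:R != 0 :> R by rewrite pnatr_eq0.
apply: (mulfI n0); rewrite !coef_bell_gen //.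
by apply: eq_bigr => k _; rewrite IH //; lia.
Qed.

Lemma coef_bell_genE n : (bell_gen n)`_n =
  \sum_(f : {ffun 'I_n -> 'I_n.+1} | (\sum_(k < n) k.+1 * f k == n)%N)
    y ^+ (\sum_(k < n) f k) *
    \prod_(k < n) ((x k.+1 / k.+1`!%:R) ^+ f k / (f k)`!%:R).
Proof.
rewrite /bell_gen /trunc_exp bigA_distr_bigA coef_sum [in RHS]big_mkcond /=.
apply: eq_bigr => f _.
have -> : \prod_(k < n) (((y * (x k.+1 / k.+1`!%:R)) ^+ f k / (f k)`!%:R) *:
      'X^(k.+1 * f k)) =
    (\prod_(k < n) ((y * (x k.+1 / k.+1`!%:R)) ^+ f k / (f k)`!%:R)) *:
     'X^(\sum_(k < n) k.+1 * f k) :> {poly R}.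
  elim: (index_enum _) => [|k r IH]; first by rewrite !big_nil expr0 scale1r.
  by rewrite !big_cons IH exprD -scalerAl -(scalerAr _ 'X^_) scalerA.
rewrite coefZ coefXn eq_sym; case: eqP => _; rewrite ?mulr0 // mulr1.
rewrite expr_sum -big_split /=; apply: eq_bigr => k _.
by rewrite exprMn mulrA.
Qed.

(** The constraints force the multiplicities at indices k >= n - j + 1 to vanish, so sequences may
    be padded with zeros to a length that no longer depends on [j]. *)
Lemma bell_partialE n j : (0 < j <= n)%N ->
  bell_partial n j x = n`!%:R *
  \sum_(f : {ffun 'I_n -> 'I_n.+1} |
          (\sum_(k < n) k.+1 * f k == n)%N && (\sum_(k < n) f k == j)%N)
    \prod_(k < n) ((x k.+1 / k.+1`!%:R) ^+ f k / (f k)`!%:R).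
Proof.
move=> /andP[j0 jn]; have le : (n - j + 1 <= n)%N by lia.
set m := (n - j + 1)%N in le *.
pose ext (i : {ffun 'I_m -> 'I_n.+1}) : {ffun 'I_n -> 'I_n.+1} :=
  [ffun k : 'I_n => if insub (k : nat) is Some k' then i k' else ord0].
pose res (f : {ffun 'I_n -> 'I_n.+1}) : {ffun 'I_m -> 'I_n.+1} :=
  [ffun k => f (widen_ord le k)].
have extE i (k : 'I_m) : ext i (widen_ord le k) = i k.
  by rewrite ffunE /=; case: insubP => [k' _ /val_inj -> //|]; rewrite ltn_ord.
have ext0 i (k : 'I_n) : (m <= k)%N -> ext i k = ord0.
  by move=> mk; rewrite ffunE; case: insubP => // k'; rewrite ltnNge mk.
have bigE (T : Type) (idx : T) (op : Monoid.com_law idx) i (F : nat -> 'I_n.+1 -> T) :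
    (forall k, F k ord0 = idx) ->
    \big[op/idx]_(k < n) F k (ext i k) = \big[op/idx]_(k < m) F k (i k).
  move=> F0.
  rewrite (bigID (fun k : 'I_n => (k < m)%N)) /= [X in op _ X]big1 => [|k].
    rewrite Monoid.mulm1 (big_ord_narrow le).
    by apply: eq_bigr => k _; rewrite extE.
  by rewrite -leqNgt => /(ext0 i) ->.
rewrite /bell_partial -/m mulr_sumr.
rewrite [RHS](reindex_onto ext res) /=; last first.
  move=> f /andP[/eqP f1 /eqP f2]; apply/ffunP => k; rewrite ffunE.
  case: insubP => [k' _ kk'|]; first by rewrite ffunE; congr (f _); apply/val_inj.
  rewrite -leqNgt => mk; apply/val_inj => /=.
  (* The difference of the two constraints; as n - j < m <= k, a positive [f k] would make this sum
     too large. *)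
  have : (\sum_(k < n) k * f k = n - j)%N.
    rewrite -[in RHS]f1 -[in RHS]f2 -sumnB => [|i _]; last by rewrite mulSn leq_addr.
    by apply: eq_bigr => i _; rewrite mulSn addnC addnK.
  rewrite (bigD1 k) //=; case: (f k : nat) => // p.
  rewrite /m in mk; nia.
apply: eq_big => [i|i /andP[/eqP i1 /eqP i2]].
  rewrite (bigE _ _ _ i (fun k v => k.+1 * v)%N) => [|k]; last by rewrite muln0.
  rewrite (bigE _ _ _ i (fun k v => v : nat)) //.
  suff -> : res (ext i) == i by rewrite andbT.
  by apply/eqP/ffunP => k; rewrite ffunE extE.
rewrite (bigE R 1 *%R i
  (fun k v => (x k.+1 / k.+1`!%:R) ^+ v / v`!%:R)) => [|k]; last first.
  by rewrite expr0 fact0 divr1.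
by rewrite big_split /= -prodfV mulrA mulrAC -mulrA.
Qed.

Lemma partition_polynomialE n : (0 < n)%N ->
  partition_polynomial n y x = n`!%:R * (bell_gen n)`_n.
Proof.
move=> n0; rewrite /partition_polynomial coef_bell_genE mulr_sumr.
rewrite (eq_big_nat _ _ (F2 := fun j => \sum_(f : {ffun 'I_n -> 'I_n.+1} |
    (\sum_(k < n) k.+1 * f k == n)%N && (\sum_(k < n) f k == j)%N)
    n`!%:R * (y ^+ (\sum_(k < n) f k) *
    \prod_(k < n) ((x k.+1 / k.+1`!%:R) ^+ f k / (f k)`!%:R)))); last first.
  move=> j j1n; rewrite bell_partialE // mulrCA !mulr_sumr.
  by apply: eq_bigr => f /andP[_ /eqP ->].
rewrite (exchange_big_dep (fun f : {ffun 'I_n -> 'I_n.+1} =>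
  (\sum_(k < n) k.+1 * f k == n)%N)) /=; last by move=> j f _ /andP[].
apply: eq_bigr => f fn; set s := (\sum_(k < n) f k)%N.
rewrite (eq_bigl (fun j => j == s)) => [|j]; last by rewrite fn eq_sym.
(* Each sequence is counted for exactly one [j], its total [s], which lies in the range: s <= n by
   the weights, and s > 0 because n > 0. *)
rewrite big_nat1_eq ifT //; apply/andP; split; last first.
  rewrite ltnS -[leqRHS](eqP fn).
  by apply: leq_sum => k _; rewrite leq_pmull.
rewrite lt0n; apply: contraTneq n0 => /eqP; rewrite sum_nat_eq0 => /forallP f0.
by rewrite -(eqP fn) big1 // => k _; rewrite (eqP (f0 k)) muln0.
Qed.

Lemma bell_polynomial_rec n : bell_polynomial n.+1 y x =
  y * \sum_(k < n.+1) 'C(n, k)%:R * x k.+1 * bell_polynomial (n - k) y x.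
Proof.
have GE m : bell_polynomial m y x = m`!%:R * (bell_gen m)`_m.
  by case: m => [|m]; rewrite ?bell_gen0 ?mulr1 -?partition_polynomialE.
have n0 m : m`!%:R != 0 :> R by rewrite pnatr_eq0 -lt0n fact_gt0.
rewrite (GE n.+1) factS natrM (mulrC n.+1%:R) -mulrA coef_bell_gen // !mulr_sumr.
apply: eq_bigr => k _; have kn : (k <= n)%N by rewrite -ltnS.
rewrite GE (@bell_gen_stable (n - k) n.+1) ?leq_subr//; last by lia.
rewrite /zc -(bin_fact kn) factS !natrM.
have k0 : k.+1%:R != 0 :> R by rewrite pnatr_eq0.
by field; rewrite addrC natr1 k0 n0.
Qed.

End bell.

(** * Faa di Bruno's formula *)

Section faa_di_bruno.
Variables (R : realType) (y K : R) (u : nat -> R -> R).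

(** When every [u k.+1] is the derivative of [u k], this is the [n]-th derivative of K exp(y
    u_0). *)
Definition faa_di_bruno (n : nat) (l : R) : R :=
  K * expR (y * u 0 l) *
  bell_polynomial n y (fun k => u k l).

(** Leibniz's formula for the [n]-th derivative of F' = y u_1 F, where F = K exp(y u_0). *)
Lemma faa_di_bruno_rec n l : faa_di_bruno n.+1 l =
  \sum_(k < n.+1) (y * 'C(n, k)%:R) * (u k.+1 l * faa_di_bruno (n - k) l).
Proof.
rewrite /faa_di_bruno bell_polynomial_rec !mulr_sumr.
by apply: eq_bigr => k _; ring.
Qed.

Lemma pascal_sum n (a b : nat -> R) :
  \sum_(k < n.+1) 'C(n, k)%:R * (a k.+1 * b (n - k)%N + a k * b (n - k).+1) =
  \sum_(k < n.+2) 'C(n.+1, k)%:R * (a k * b (n.+1 - k)%N).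
Proof.
under eq_bigr do rewrite mulrDr.
rewrite big_split /= [in RHS]big_ord_recl [X in _ + X = _]big_ord_recl /=.
under [in RHS]eq_bigr => k _ do
  rewrite /bump /= add1n binS natrD mulrDl subSS.
rewrite big_split /= [X in _ = _ + (X + _)]big_ord_recr /=.
rewrite !bin0 bin_small // mul0r addr0 !subn0 addrCA; congr (_ + _).
rewrite addrC; congr (_ + _).
apply: eq_bigr => k _; rewrite /bump /= add1n.
by rewrite -subSn // subSS.
Qed.

(** By strong induction the products in [faa_di_bruno_rec] have known derivatives, and Pascal's
    rule, in the form [pascal_sum], regroups them into the same recurrence one order higher. *)
Lemma is_derive_faa_di_bruno (l : R) :
  (forall k, is_derive l 1 (u k) (u k.+1 l)) ->
  forall n, is_derive l 1 (faa_di_bruno n) (faa_di_bruno n.+1 l).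
Proof.
move=> du; elim/ltn_ind => -[_|n IH].
  rewrite faa_di_bruno_rec big_ord1 bin0.
  have -> : faa_di_bruno 0 = K \*: ((expR : R -> R) \o (y \*: u 0)).
    by apply/funext => z; rewrite /faa_di_bruno mulr1.
  apply: is_derive_eq; rewrite /= /faa_di_bruno /=.
  by rewrite /GRing.scale /=; ring.
have -> : faa_di_bruno n.+1 = \sum_(k < n.+1)
    ((y * 'C(n, k)%:R) \*: (u k.+1 * faa_di_bruno (n - k))).
  by apply/funext => z; rewrite faa_di_bruno_rec fct_sumE.
have -> : faa_di_bruno n.+2 l = \sum_(k < n.+1) (y * 'C(n, k)%:R) *
    (u k.+1 l * faa_di_bruno (n - k).+1 l + u k.+2 l * faa_di_bruno (n - k) l).
  rewrite faa_di_bruno_rec.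
  under eq_bigr do rewrite -mulrA.
  rewrite -mulr_sumr -(pascal_sum n (fun k => u k.+1 l) (fun k => faa_di_bruno k l)).
  rewrite mulr_sumr; apply: eq_bigr => k _.
  by rewrite -mulrA [X in _ * (_ * X) = _]addrC.
apply: is_derive_sum => k; apply: is_deriveZ.
have IHk : is_derive l 1 (faa_di_bruno (n - k)) (faa_di_bruno (n - k).+1 l).
  by apply: IH; rewrite ltnS leq_subr.
apply: is_derive_eq; rewrite /GRing.scale /=; ring.
Qed.

End faa_di_bruno.

(** * Derivatives of sqrt(1 + q l) and their values at 0 *)

Section sqrt_derivatives.
Variables (R : realType) (q : R).

Definition sqrt_derivative (k : nat) (l : R) : R :=
  falling_factorial (1 / 2) k * q ^+ k * (1 + q * l) `^ (1 / 2 - k%:R).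

Lemma is_derive_sqrt_derivative (k : nat) (l : R) : 0 < 1 + q * l ->
  is_derive l 1 (sqrt_derivative k) (sqrt_derivative k.+1 l).
Proof.
move=> ql.
have -> : sqrt_derivative k = (falling_factorial (1 / 2) k * q ^+ k) \*:
    ((@powR R) ^~ (1 / 2 - k%:R) \o (cst 1 + q \*: (id : R -> R))).
  by [].
have h : is_derive ((cst 1 + q \*: (id : R -> R)) l) 1
      ((@powR R) ^~ (1 / 2 - k%:R))
      ((1 / 2 - k%:R) * (1 + q * l) `^ (1 / 2 - k%:R - 1)).
  exact: is_derive1_powR.
apply: is_derive_eq.
rewrite /sqrt_derivative /falling_factorial big_ord_recr /= exprSr.
rewrite /GRing.scale /= (_ : 1 / 2 - k.+1%:R = 1 / 2 - k%:R - 1); last first.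
  by rewrite -natr1; ring.
ring.
Qed.

Lemma sqrt_derivative0 k : sqrt_derivative k 0 = q ^+ k * falling_factorial (1 / 2) k.
Proof. by rewrite /sqrt_derivative mulr0 addr0 powR1 mulr1 mulrC. Qed.

End sqrt_derivatives.

(** G_n is homogeneous of weight n when x_k has weight k. *)
Lemma bell_polynomial_scale (R : numFieldType) (n : nat) (y q : R) (x : nat -> R) :
  bell_polynomial n y (fun k => q ^+ k * x k) = q ^+ n * bell_polynomial n y x.
Proof.
elim/ltn_ind: n => -[_|n IH]; first by rewrite mul1r.
rewrite !bell_polynomial_rec [RHS]mulrCA; congr (_ * _); rewrite mulr_sumr.
apply: eq_bigr => k _; rewrite IH ?ltnS ?leq_subr//.
have -> : q ^+ n.+1 = q ^+ k.+1 * q ^+ (n - k).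
  by rewrite -exprD addSn subnKC // -ltnS.
ring.
Qed.

Lemma faa_di_bruno_sqrt0 (R : realType) (y q : R) n :
  faa_di_bruno y (expR (- y)) (sqrt_derivative q) n 0 =
  q ^+ n * bell_polynomial n y (falling_factorial (1 / 2)).
Proof.
rewrite /faa_di_bruno sqrt_derivative0 expr0 mul1r /falling_factorial big_ord0.
rewrite mulr1 -expRD addNr expR0 mul1r -bell_polynomial_scale; congr bell_polynomial.
by apply/funext => k; rewrite sqrt_derivative0.
Qed.

(** * Moments from the Laplace transform *)

(** A single term (l x)^n / n! of the exponential series is at most exp(l x). This bound dominates
    the derivatives of the Laplace transform and, later, the error terms of the grid
    approximation. *)
Lemma expr_expRN_le (R : realType) (n : nat) (l x : R) : 0 < l -> 0 <= x ->
  x ^+ n * expR (- l * x) <= n`!%:R / l ^+ n.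
Proof.
move=> l0 x0; have ln0 : 0 < l ^+ n by rewrite exprn_gt0.
rewrite ler_pdivlMr // mulrAC -exprMn mulNr expRN mulrC ler_pdivrMl ?expR_gt0 //.
have n0 : 0 < n`!%:R :> R by rewrite ltr0n fact_gt0.
rewrite -ler_pdivrMr // [x * l]mulrC.
case: n {ln0} n0 => [|n] n0.
  by rewrite expr0 fact0 divr1 -expR0 ler_expR mulr_ge0 // ltW.
apply: le_trans (expR_ge1Dxn n (mulr_ge0 (ltW l0) x0)).
by rewrite lerDr.
Qed.

Section laplace_moments.
Context (R : realType) (d : measure_display) (T : measurableType d)
  (P : probability T R) (A : set T) (X : T -> R).
Hypotheses (mA : measurable A) (mX : measurable_fun setT X)
  (X0 : forall w, 0 <= X w).

Let F (n : nat) (l : R) (w : T) : R := X w ^+ n * expR (- l * X w).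

Let mF n l : measurable_fun setT (F n l).
Proof.
apply: measurable_funM; first exact: measurable_funX.
by apply: measurableT_comp => //; exact: measurable_funM.
Qed.

Let intF n (l : R) : 0 < l -> P.-integrable A (EFin \o F n l).
Proof.
move=> l0.
apply: (le_integrable mA _ _ (finite_measure_integrable_cst P (n`!%:R / l ^+ n) mA)).
  by apply/measurable_EFinP; apply: measurable_funTS; exact: mF.
move=> w _ /=; rewrite lee_fin ger0_norm ?mulr_ge0 ?exprn_ge0 ?expR_ge0 //.
by apply: le_trans (ler_norm _); exact: expr_expRN_le.
Qed.

Let derF n (l : R) w : is_derive l 1 (fun l : R => F n l w : R) (- F n.+1 l w).
Proof.
rewrite /F (_ : (fun l => _) = (X w ^+ n) \*:
    ((expR : R -> R) \o ((- X w) \*: (id : R -> R)))).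
  apply: is_derive_eq; rewrite /GRing.scale /= exprS mulr1.
  by rewrite (_ : - l * X w = - X w * l); ring.
by apply/funext => z /=; rewrite (_ : - z * X w = - X w * z) //; ring.
Qed.

Lemma is_derive_laplace n (l : R) : 0 < l ->
  is_derive l 1 (fun l => \int[P]_(w in A) F n l w)
    (- \int[P]_(w in A) F n.+1 l w).
Proof.
move=> l0.
have Il : `]l / 2, l + 1[%classic l.
  by rewrite /= in_itv /=; apply/andP; split; lra.
have pos (x : R) : `]l / 2, l + 1[%classic x -> 0 < x.
  by rewrite /= in_itv /= => /andP[+ _]; apply: lt_trans; lra.
have iF x : `]l / 2, l + 1[%classic x -> P.-integrable A (EFin \o F n x).
  by move=> /pos; exact: intF.
have dF (x : R) (w : T) : `]l / 2, l + 1[%classic x -> A w ->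
    derivable (fun x => F n x w) x 1.
  by move=> _ _; have := derF n x w; case.
have d1 x w : partial1of2 (F n) x w = - F n.+1 x w.
  by rewrite partial1of2E; have := derF n x w; case.
(* The bound of [expr_expRN_le] at the left end l / 2 holds uniformly on the interval, and a
   constant is integrable for a probability. *)
pose c : R := n.+1`!%:R / (l / 2) ^+ n.+1.
have c0 (w : T) : 0 <= cst c w.
  by rewrite /c /= divr_ge0 // exprn_ge0 // divr_ge0 // ltW.
have ic : P.-integrable A (EFin \o cst c) by exact: finite_measure_integrable_cst.
have ub (x : R) (w : T) : `]l / 2, l + 1[%classic x -> A w ->
    `|partial1of2 (F n) x w| <= cst c w.
  move=> Ix Aw; rewrite d1 normrN ger0_norm ?mulr_ge0 ?exprn_ge0 ?expR_ge0 //.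
  apply: le_trans (expr_expRN_le n.+1 _ (X0 w)); last by rewrite divr_gt0.
  rewrite ler_wpM2l ?exprn_ge0 // ler_expR !mulNr lerN2 ler_wpM2r //.
  by move: Ix; rewrite /= in_itv /= => /andP[/ltW].
split; first exact: (derivable_under_integral mA Il iF dF c0 ic ub).
rewrite -derive1E (differentiation_under_integral mA Il iF dF c0 ic ub).
under eq_Rintegral do rewrite d1.
rewrite -[RHS]mulN1r -RintegralZl //; last exact: intF.
by apply: eq_Rintegral => w _; rewrite mulN1r.
Qed.

(** For l > 0 the derivatives of both sides agree. As l decreases to 0, the integrals converge by
    monotone convergence, so no integrability of [X ^+ n] is assumed, and [g n] converges by
    continuity at 0. *)
Lemma laplace_moments (g : nat -> R -> R) :
  (forall n (l : R), 0 <= l -> is_derive l 1 (g n) (g n.+1 l)) ->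
  (forall l : R, 0 < l -> \int[P]_(w in A) expR (- l * X w) = g 0 l) ->
  forall n, (\int[P]_(w in A) (X w ^+ n)%:E = ((- 1) ^+ n * g n 0)%:E)%E.
Proof.
move=> dg gL n.
have Fg m (l : R) : 0 < l -> \int[P]_(w in A) F m l w = (- 1) ^+ m * g m l.
  elim: m l => [|m IH] l l0.
    rewrite mul1r -gL //; apply: eq_Rintegral => w _.
    by rewrite /F mul1r.
  have d1 : is_derive l 1 (fun l => \int[P]_(w in A) F m l w) ((-1) ^+ m * g m.+1 l).
    have h : is_derive l 1 ((-1) ^+ m \*: g m) ((-1) ^+ m * g m.+1 l).
      by apply: is_deriveZ; apply: dg; exact: ltW.
    apply: near_eq_is_derive h.
    near=> z; rewrite /= IH //; near: z; exact: lt_nbhsr.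
  have [_ d2] := is_derive_laplace m l0; have [_] := d1; rewrite d2 => {}d2.
  by rewrite exprS -mulrA -d2 mulN1r opprK.
pose l_ (j : nat) : R := j.+1%:R^-1.
have l_gt0 j : 0 < l_ j by rewrite invr_gt0 ltr0n.
have cv1 : (\int[P]_(w in A) (F n (l_ j) w)%:E @[j --> \oo] -->
    \int[P]_(w in A) (X w ^+ n)%:E)%E.
  have -> : (\int[P]_(w in A) (X w ^+ n)%:E)%E =
      (\int[P]_(w in A) limn (fun j => (F n (l_ j) w)%:E))%E.
    apply: eq_integral => w _; apply/esym/cvg_lim => //.
    apply/cvg_EFin; first by near=> j.
    rewrite /= -[X in _ --> X]mulr1; apply: cvgMl_tmp.
    rewrite -expR0; apply: continuous_cvg; first exact: continuous_expR.
    rewrite -(mul0r (X w)); apply: cvgMr_tmp.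
    by rewrite -oppr0; apply: cvgN; exact: cvg_harmonic.
  apply: cvg_monotone_convergence => //.
  - by move=> j; apply/measurable_EFinP; apply: measurable_funTS; exact: mF.
  - by move=> j w _; rewrite lee_fin mulr_ge0 ?exprn_ge0 ?expR_ge0.
  - move=> w _ j k jk; rewrite lee_fin ler_wpM2l ?exprn_ge0 // ler_expR.
    by rewrite !mulNr lerN2 ler_wpM2r // lef_pV2 ?posrE ?ltr0n // ler_nat.
have cv2 : (\int[P]_(w in A) (F n (l_ j) w)%:E @[j --> \oo] -->
    ((- 1) ^+ n * g n 0)%:E)%E.
  rewrite (_ : (fun j => _) = (fun j => ((- 1) ^+ n * g n (l_ j))%:E)); last first.
    apply/funext => j; rewrite -Fg // /Rintegral fineK //.
    by apply: integrable_fin_num => //; exact: intF.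
  apply/cvg_EFin; first by near=> j.
  have cg : {for 0, continuous (g n)}.
    apply: differentiable_continuous; apply/derivable1_diffP.
    by have [] := dg n 0 (lexx _).
  apply: cvgMl_tmp; apply: (continuous_cvg _ cg).
  exact: cvg_harmonic.
exact: cvg_unique cv1 cv2.
Unshelve. all: by end_near. Qed.

End laplace_moments.

(** * Gaussian increments and independence *)

Section normal_mgf.
Variable R : realType.
Local Notation leb := (@lebesgue_measure R).
Local Open Scope ereal_scope.

(** The Radon-Nikodym derivative with respect to Lebesgue measure and the density have the same
    integral over every measurable set, hence agree almost everywhere. *)
Lemma ge0_integral_normal_prob (m s : R) (f : R -> \bar R) :
  measurable_fun setT f -> (forall x, 0 <= f x) ->
  \int[normal_prob m s]_x f x = \int[leb]_x (f x * (normal_pdf m s x)%:E).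
Proof.
move=> mf f0.
have dom := @normal_prob_dominates R m s.
rewrite -(Radon_Nikodym_SigmaFinite.change_of_variables dom) //.
have mpdf : measurable_fun setT (fun x => (normal_pdf m s x)%:E).
  by apply/measurable_EFinP; exact: measurable_normal_pdf.
have iRN := Radon_Nikodym_SigmaFinite.f_integrable dom.
have mRN := measurable_int _ iRN.
apply: ae_eq_integral => //.
- exact: emeasurable_funM.
- exact: emeasurable_funM.
- apply: ae_eqe_mul2l.
  apply: integral_ae_eq => //= E _ mE.
  by rewrite -Radon_Nikodym_SigmaFinite.f_integral.
Qed.

Lemma normal_prob_mgf (tau s : R) : (0 < tau)%R ->
  \int[normal_prob 0 tau]_x (expR (s * x))%:E = (expR (s ^+ 2 * tau ^+ 2 / 2))%:E.
Proof.
move=> tau0.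
have mexp : measurable_fun setT (fun x : R => (expR (s * x))%:E).
  by apply/measurable_EFinP; apply: measurableT_comp => //; exact: measurable_funM.
rewrite ge0_integral_normal_prob => [|//|x]; last by rewrite lee_fin expR_ge0.
(* Completing the square turns the tilted density into a normal density with mean [s * tau ^+ 2]. *)
transitivity (\int[leb]_x ((expR (s ^+ 2 * tau ^+ 2 / 2))%:E *
    (normal_pdf (s * tau ^+ 2) tau x)%:E)).
  apply: eq_integral => x _; rewrite -!EFinM; congr EFin.
  have t0 : tau != 0%R by rewrite gt_eqF.
  rewrite !normal_pdfE // /normal_fun mulrCA [RHS]mulrCA -!expRD; congr (_ * expR _)%R.
  by rewrite -(mulr_natr (tau ^+ 2)%R 2); field.
rewrite ge0_integralZl_EFin ?expR_ge0 //.
- by rewrite integral_normal_pdf mule1.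
- by move=> x _; rewrite lee_fin normal_pdf_ge0.
- by apply/measurable_EFinP; exact: measurable_normal_pdf.
Qed.

End normal_mgf.

Section independence.
Local Open Scope ereal_scope.
Context (R : realType) (d : measure_display) (T : measurableType d)
  (P : probability T R).

(** Both sides are finite measures in [C] that agree on the rectangles, a generating class stable
    under intersection. *)
Lemma independent_pair_event (X Y : T -> R) (F : set T) :
  measurable_fun setT X -> measurable_fun setT Y -> measurable F ->
  (forall A B, measurable A -> measurable B ->
    P (X @^-1` A `&` Y @^-1` B `&` F) = P (X @^-1` A `&` Y @^-1` B) * P F) ->
  forall C : set (R * R), measurable C ->
    P ((fun w => (X w, Y w)) @^-1` C `&` F) =
    P ((fun w => (X w, Y w)) @^-1` C) * P F.
Proof.
move=> mX mY mF XYF C mC.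
have mXY : measurable_fun setT (fun w => (X w, Y w)) by exact: measurable_fun_pair.
pose m1 : {measure set (R * R) -> \bar R} :=
  measure_function_pushforward__canonical__measure_function_Measure (mrestr P mF) mXY.
pose m2 : {measure set (R * R) -> \bar R} :=
  measure_function_pushforward__canonical__measure_function_Measure
    (mscale (NngNum (fine_ge0 (measure_ge0 P F))) P) mXY.
have PF : (fine (P F))%:E = P F by rewrite fineK // fin_num_measure.
suff : m1 C = m2 C by rewrite /m1 /m2 /= /pushforward /mrestr /mscale /= PF muleC.
pose G : set (set (R * R)) := [set A `*` B | A in measurable & B in measurable].
apply: (measure_unique G (fun=> setT)) => //.
- exact: measurable_prod_measurableType.
- move=> _ _ [A1 mA1 [B1 mB1 <-]] [A2 mA2 [B2 mB2 <-]]; rewrite -setXI.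
  exists (A1 `&` A2); first exact: measurableI.
  by exists (B1 `&` B2) => //; exact: measurableI.
- by move=> _; exists setT => //; exists setT => //; rewrite setXTT.
- by rewrite bigcup_const.
- move=> _ [A mA [B mB <-]]; rewrite /m1 /m2 /= /pushforward /mrestr /mscale /= PF muleC.
  exact: XYF.
- move=> _; rewrite /m1 /= /pushforward /mrestr preimage_setT setTI.
  by rewrite ltey_eq fin_num_measure.
Qed.

Lemma ge0_expectation_prod (X Y : {RV P >-> R}) (f g : R -> R) :
  measurable_fun setT f -> measurable_fun setT g ->
  (forall x, (0 <= f x)%R) -> (forall x, (0 <= g x)%R) ->
  (forall A B, measurable A -> measurable B ->
    P (X @^-1` A `&` Y @^-1` B) = P (X @^-1` A) * P (Y @^-1` B)) ->
  \int[P]_w (f (X w) * g (Y w))%:E =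
  (\int[P]_w (f (X w))%:E) * (\int[P]_w (g (Y w))%:E).
Proof.
move=> mf mg f0 g0 XY.
have mXY : measurable_fun setT (fun w => (X w, Y w)) by exact: measurable_fun_pair.
pose m' : {measure set (R * R) -> \bar R} :=
  measure_function_pushforward__canonical__measure_function_Measure P mXY.
have prodE := @product_measure_unique _ _ _ _ _
  (distribution P X) (distribution P Y) m' XY.
pose h (z : R * R) := (f z.1 * g z.2)%:E.
have mh : measurable_fun setT h.
  by apply/measurable_EFinP; apply: measurable_funM; apply: measurableT_comp.
have h0 z : 0 <= h z by rewrite lee_fin mulr_ge0.
transitivity (\int[m']_z h z).
  by rewrite ge0_integral_pushforward.
transitivity (\int[(distribution P X \x distribution P Y)]_z h z).
  by apply: eq_measure_integral => A mA _; exact/esym/prodE.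
rewrite fubini_tonelli1 // /fubini_F /=.
rewrite -(ge0_integral_distribution X (f := EFin \o f)) //; last exact/measurable_EFinP.
rewrite -(ge0_integral_distribution Y (f := EFin \o g)) //; last exact/measurable_EFinP.
rewrite -ge0_integralZr //.
- apply: eq_integral => x _; rewrite /h /=.
  under eq_integral do rewrite EFinM.
  by rewrite ge0_integralZl_EFin //; [move=> y _; rewrite lee_fin|exact/measurable_EFinP].
- exact/measurable_EFinP.
- by move=> x _; rewrite lee_fin.
- by apply: integral_ge0 => x _; rewrite lee_fin.
Qed.

End independence.

Section chain_independence.
Local Open Scope ereal_scope.
Context (R : realType) (d : measure_display) (T : measurableType d)
  (P : probability T R) (N : nat) (D : nat -> {RV P >-> R}).
Hypothesis D_indep : mutually_independent P (fun i : 'I_N => D i).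

Let tail (k : nat) (B : nat -> set R) : set T :=
  \bigcap_(i in [set i | k <= i < N]%N) (D i @^-1` B i).

Let tailS k B : (k < N)%N -> tail k B = D k @^-1` B k `&` tail k.+1 B.
Proof.
move=> kN; apply/seteqP; split => w /= H.
  split; first by apply: H; rewrite /= leqnn.
  by move=> i /= /andP[ki iN]; apply: H; rewrite /= iN ltnW.
move=> i /= /andP[]; rewrite leq_eqVlt => /predU1P[<- _|ki iN]; first by case: H.
by case: H => _; apply; rewrite /= ki.
Qed.

Let measurable_tail k B : (forall i, measurable (B i)) -> measurable (tail k B).
Proof.
by move=> mB; apply: bigcap_measurableType => i _; exact: measurable_funPTI.
Qed.

Let tail_prod k B : (forall i, measurable (B i)) ->
  P (tail k B) = \prod_(i in [set i : 'I_N | (k <= i)%N]%SET) P (D i @^-1` B i).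
Proof.
move=> mB; rewrite -(D_indep [set i : 'I_N | (k <= i)%N]%SET (fun i => mB i)).
congr (P _); apply/seteqP; split => w /= H i.
  by rewrite /= inE => ki; apply: H; rewrite /= ki ltn_ord.
by move=> /andP[ki iN]; apply: (H (Ordinal iN)); rewrite /= inE.
Qed.

Let tail_mul k B : (k < N)%N -> (forall i, measurable (B i)) ->
  P (tail k B) = P (D k @^-1` B k) * P (tail k.+1 B).
Proof.
move=> kN mB; rewrite !tail_prod // (bigD1 (Ordinal kN)) ?inE //=.
congr (_ * _); apply: eq_bigl => i; rewrite !inE -val_eqE /=; lia.
Qed.

Variables (g : nat -> R * R -> R) (Z : nat -> T -> R) (z0 : R).
Hypotheses (mg : forall k, measurable_fun setT (g k))
  (Z0 : Z 0 = cst z0) (ZS : forall k, Z k.+1 = fun w => g k (Z k w, D k w)).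

Lemma measurable_chain k : measurable_fun setT (Z k).
Proof.
elim: k => [|k IH]; first by rewrite Z0.
rewrite ZS; apply: (measurableT_comp (mg k)).
by apply: measurable_fun_pair.
Qed.

(** [Z k.+1] is a function of [Z k] and [D k], which by induction are jointly independent of the
    later increments. *)
Let chain_tail k A B : (k <= N)%N -> measurable A -> (forall i, measurable (B i)) ->
  P (Z k @^-1` A `&` tail k B) = P (Z k @^-1` A) * P (tail k B).
Proof.
elim: k A B => [|k IH] A B kN mA mB.
  rewrite Z0 preimage_cst; case: ifPn => _.
    by rewrite setTI probability_setT mul1e.
  by rewrite set0I measure0 mul0e.
have preim A' : Z k.+1 @^-1` A' = (fun w => (Z k w, D k w)) @^-1` (g k @^-1` A').
  by rewrite ZS.
rewrite !preim; apply: independent_pair_event => //.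
- exact: measurable_chain.
- exact: measurable_tail.
- move=> A' B' mA' mB'.
  (* Both families constrain [D k] by [B']; [B1] keeps the later constraints and [B2] drops them.
     The induction hypothesis for each gives the two probabilities to compare. *)
  pose B1 i := if i == k then B' else B i.
  pose B2 i := if i == k then B' else setT.
  have mB1 i : measurable (B1 i) by rewrite /B1; case: ifP.
  have mB2 i : measurable (B2 i) by rewrite /B2; case: ifP.
  have t1 : tail k.+1 B1 = tail k.+1 B.
    by apply: eq_bigcapr => i /= ?; rewrite /B1 ifF //; apply/eqP; lia.
  have t2 : tail k.+1 B2 = setT.
    apply/seteqP; split => // w _ i /= ?; rewrite /B2 ifF //; apply/eqP; lia.
  have := IH A' B1 (ltnW kN) mA' mB1; have := IH A' B2 (ltnW kN) mA' mB2.
  rewrite (tail_mul kN mB2) (tail_mul kN mB1) (tailS B1 kN) (tailS B2 kN).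
  rewrite t1 t2 setIT probability_setT mule1 /B1 /B2 eqxx setIA => -> ->.
  by rewrite muleA.
- by rewrite -[X in measurable X]setTI; exact: mg.
Qed.

Lemma chain_independent k A B : (k < N)%N -> measurable A -> measurable B ->
  P (Z k @^-1` A `&` D k @^-1` B) = P (Z k @^-1` A) * P (D k @^-1` B).
Proof.
move=> kN mA mB; pose B2 i := if i == k then B else setT.
have mB2 i : measurable (B2 i) by rewrite /B2; case: ifP.
have := chain_tail (ltnW kN) mA mB2.
have t2 : tail k.+1 B2 = setT.
  apply/seteqP; split => // w _ i /= ?; rewrite /B2 ifF //; apply/eqP; lia.
by rewrite (tail_mul kN mB2) (tailS _ kN) t2 setIT probability_setT mule1 /B2 eqxx.
Qed.

End chain_independence.

(** * Optional stopping in discrete time *)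

Section killed_walk.
Context (R : realType) (d : measure_display) (T : measurableType d)
  (P : probability T R) (D : nat -> {RV P >-> R}) (th h : R) (c : nat -> R).

(** One factor of the exponential martingale; its mean is 1 when [D k] is centred Gaussian with
    variance [h]. *)
Definition wald (k : nat) (w : T) : R := expR (th * D k w - th ^+ 2 * h / 2).

(* The exponential martingale [\prod_k wald k], killed as soon as it exceeds the
   barrier [c]. *)
Fixpoint killed (k : nat) (w : T) : R :=
  if k is k'.+1 then
    if killed k' w * wald k' w <= c k'.+1 then killed k' w * wald k' w else 0
  else 1.

Definition crossing (k : nat) (w : T) : bool := c k.+1 < killed k w * wald k w.

(** For a positive barrier at most one term is nonzero, since [killed] stays 0 after a crossing:
    this is the barrier at the first crossing, or 0 if there is none. *)
Definition crossing_sum (N : nat) (w : T) : R :=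
  \sum_(k < N) c k.+1 * (crossing k w)%:R.

Let step (k : nat) (z : R * R) : R :=
  let u := z.1 * expR (th * z.2 - th ^+ 2 * h / 2) in if u <= c k.+1 then u else 0.

Let measurable_step k : measurable_fun setT (step k).
Proof.
have mu : measurable_fun setT
    (fun z : R * R => z.1 * expR (th * z.2 - th ^+ 2 * h / 2)).
  apply: measurable_funM; first exact: measurable_fst.
  apply: measurableT_comp => //; apply: measurable_funB => //.
  apply: measurable_funM => //; exact: measurable_snd.
by rewrite /step; apply: measurable_fun_ifT => //; exact: measurable_fun_ler.
Qed.

Lemma measurable_killed k : measurable_fun setT (killed k).
Proof. exact: (measurable_chain (D := D) measurable_step (z0 := 1)). Qed.

Lemma killed_ge0 k w : 0 <= killed k w.
Proof.
elim: k => [|k IH] //=; case: ifP => // _.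
by rewrite mulr_ge0 // expR_ge0.
Qed.

Lemma measurable_wald k : measurable_fun setT (wald k).
Proof.
apply: measurableT_comp => //; apply: measurable_funB => //.
exact: measurable_funM.
Qed.

Let U k w := killed k w * wald k w.
Let mU k : measurable_fun setT (U k).
Proof. by apply: measurable_funM; [exact: measurable_killed|exact: measurable_wald]. Qed.
Let U_ge0 k w : 0 <= U k w.
Proof. by rewrite mulr_ge0 ?killed_ge0 ?expR_ge0. Qed.

Lemma measurable_crossing_sum N : measurable_fun setT (crossing_sum N).
Proof.
apply: measurable_sum => k; apply: measurable_funM => //.
rewrite (_ : (fun w => _) = (fun w => if c k.+1 < U k w then 1 else 0)).
  by apply: measurable_fun_ifT => //; exact: measurable_fun_ltr.
by apply/funext => w; rewrite /crossing; case: ifP.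
Qed.

Let J k w := if c k.+1 < U k w then U k w else 0.
Let mJ k : measurable_fun setT (J k).
Proof. by apply: measurable_fun_ifT => //; exact: measurable_fun_ltr. Qed.
Let J_ge0 k w : 0 <= J k w. Proof. by rewrite /J; case: ifP. Qed.

Hypothesis c0_ge1 : 1 <= c 0.
Hypothesis c_gt0 : forall k, 0 < c k.

Lemma killed_le k w : killed k w <= c k.
Proof. by case: k => [|k] //=; case: ifP => // _; exact: ltW. Qed.

Variable N : nat.
Hypothesis D_indep : mutually_independent P (fun i : 'I_N => D i).
Hypothesis D_mgf : forall k (s : R), (k < N)%N ->
  (\int[P]_w (expR (s * D k w))%:E = (expR (s ^+ 2 * h / 2))%:E)%E.

Local Open Scope ereal_scope.

Let E_mul k (p r : R) : (k < N)%N ->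
  \int[P]_w (killed k w * expR (p * D k w + r))%:E =
  \int[P]_w (killed k w)%:E * (expR (p ^+ 2 * h / 2 + r))%:E.
Proof.
move=> kN.
pose X : {RV P >-> R} :=
  HB.pack (killed k) (isMeasurableFun.Build _ _ _ _ _ (measurable_killed k)).
have mf : measurable_fun setT (fun x : R => expR (p * x + r)).
  apply: measurableT_comp => //; apply: measurable_funD => //; exact: measurable_funM.
(* The function applied to [X] must be nonnegative on all of [R]; taking [Num.max x 0] changes
   nothing because [killed] is nonnegative. *)
have := @ge0_expectation_prod _ _ _ P X (D k)
  (fun x => Num.max x 0)%R (fun x => expR (p * x + r)).
rewrite /=.
under eq_integral do rewrite (max_idPl (killed_ge0 k _)).
under [X in X * _]eq_integral do rewrite (max_idPl (killed_ge0 k _)).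
move=> -> //.
- congr (_ * _).
  under eq_integral do rewrite expRD EFinM.
  rewrite ge0_integralZr //.
  + by rewrite D_mgf // -EFinM -expRD.
  + apply/measurable_EFinP; apply: measurableT_comp => //; exact: measurable_funM.
- exact: measurable_maxr.
- by move=> x; rewrite le_max lexx orbT.
- move=> A B mA mB.
  by apply: (chain_independent D_indep measurable_step (z0 := 1%R)).
Qed.

Let E_killedS k : (k < N)%N ->
  \int[P]_w (killed k w)%:E = \int[P]_w (killed k.+1 w)%:E + \int[P]_w (J k w)%:E.
Proof.
move=> kN; transitivity (\int[P]_w (U k w)%:E).
  rewrite (_ : (fun w => (U k w)%:E) =
      (fun w => (killed k w * expR (th * D k w + (- (th ^+ 2 * h / 2))))%:E)) //.
  by rewrite E_mul // subrr expR0 mule1.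
rewrite -ge0_integralD //.
- apply: eq_integral => w _; rewrite -EFinD /= /J -/(U k w).
  by case: ltP => _; rewrite ?add0r ?addr0.
- by move=> w _; rewrite lee_fin killed_ge0.
- by apply/measurable_EFinP; exact: measurable_killed.
- by move=> w _; rewrite lee_fin.
- exact/measurable_EFinP.
Qed.

(** Optional stopping: the initial mass 1 is either still alive at [k] or was removed at an earlier
    crossing, where [J] records its value. *)
Let E_stopped k : (k <= N)%N ->
  1 = \int[P]_w (killed k w)%:E + \int[P]_w (\sum_(i < k) J i w)%:E.
Proof.
elim: k => [|k IH] kN.
  under [X in _ + X]eq_integral do rewrite big_ord0.
  by rewrite integral0 adde0 /= integral_cst //= probability_setT mule1.
rewrite IH ?(ltnW kN) // E_killedS // -addeA; congr (_ + _).
under [RHS]eq_integral do rewrite big_ord_recr /= EFinD.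
rewrite ge0_integralD //; first by rewrite addeC.
- by move=> w _; rewrite lee_fin sumr_ge0.
- by apply/measurable_EFinP; exact: measurable_sum.
- by move=> w _; rewrite lee_fin.
- exact/measurable_EFinP.
Qed.

Let E_killed_le1 k : (k <= N)%N -> \int[P]_w (killed k w)%:E <= 1.
Proof.
move=> kN; rewrite [leRHS](E_stopped kN) leeDl //.
by apply: integral_ge0 => w _; rewrite lee_fin sumr_ge0.
Qed.

Lemma crossing_sum_ge0 n w : (0 <= crossing_sum n w)%R.
Proof. by apply: sumr_ge0 => k _; rewrite mulr_ge0 // ltW. Qed.

(** At a crossing the martingale exceeds the barrier, so [crossing_sum] is at most the removed
    mass. *)
Lemma integral_crossing_sum_le1 : \int[P]_w (crossing_sum N w)%:E <= 1.
Proof.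
apply: (@le_trans _ _ (\int[P]_w (\sum_(i < N) J i w)%:E)).
  apply: ge0_le_integral => //.
  - by move=> w _; rewrite lee_fin crossing_sum_ge0.
  - by apply/measurable_EFinP; exact: measurable_crossing_sum.
  - by apply/measurable_EFinP; exact: measurable_sum.
  - move=> w _; rewrite lee_fin; apply: ler_sum => k _.
    rewrite /crossing /J -/(U k w); case: ltP => [/ltW|_]; by rewrite ?mulr1 ?mulr0.
rewrite [leRHS](E_stopped (leqnn N)) leeDr //.
by apply: integral_ge0 => w _; rewrite lee_fin killed_ge0.
Qed.

(* A crossing either overshoots the barrier by a factor at most [r], or comes
   from an exceptionally large increment, whose contribution is bounded by an
   exponential Markov inequality with exponent [p]. *)
Lemma integral_crossing_sum_ge (q r p : R) :
  (0 < r)%R -> (0 <= p)%R -> (forall k, c k <= q * c k.+1)%R ->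
  1 <= (c N + N%:R * expR (p * (p + 1) * th ^+ 2 * h / 2 - p * ln r))%:E +
    (r * q)%:E * \int[P]_w (crossing_sum N w)%:E.
Proof.
move=> r0 p0 cq.
have q0 : (0 <= q)%R by rewrite -(pmulr_lge0 _ (c_gt0 1)) (le_trans _ (cq 0%N)) ?ltW.
(* This is [U k w] times (wald / r)^p, hence at least [U k w] when [wald k w] exceeds [r]. It is
   written with an exponent linear in [D k w] so that [E_mul] applies. *)
pose H k w := (killed k w * expR ((1 + p) * th * D k w +
  (- ((1 + p) * (th ^+ 2 * h / 2)) - p * ln r)))%R.
have HE k w : H k w = (U k w * expR (p * (th * D k w - th ^+ 2 * h / 2 - ln r)))%R.
  by rewrite /H /U /wald -[RHS]mulrA -expRD; congr (_ * expR _)%R; ring.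
have H0 k w : (0 <= H k w)%R by rewrite mulr_ge0 ?killed_ge0 ?expR_ge0.
have mH k : measurable_fun setT (H k).
  apply: measurable_funM; first exact: measurable_killed.
  apply: measurableT_comp => //; apply: measurable_funD => //; exact: measurable_funM.
have JH k w : (J k w <= r * q * (c k.+1 * (crossing k w)%:R) + H k w)%R.
  rewrite /J /crossing -/(U k w); case: ltP => [cU|_]; last by rewrite !mulr0 add0r.
  (* A moderate increment gives U <= r c_k <= r q c_{k+1}; a large one is absorbed by [H]. *)
  rewrite mulr1; case: (lerP (wald k w) r) => wr.
    apply: (@le_trans _ _ (r * q * c k.+1)%R); last by rewrite lerDl.
    rewrite -mulrA (le_trans _ (ler_wpM2l (ltW r0) (cq k))) // mulrC.
    by rewrite ler_pM ?expR_ge0 ?killed_ge0 // killed_le.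
  apply: (@le_trans _ _ (H k w)); last first.
    by rewrite lerDr !mulr_ge0 // ltW.
  rewrite HE -[leLHS]mulr1 ler_wpM2l // -[leLHS]expR0 ler_expR mulr_ge0 //.
  by rewrite subr_ge0 -ler_expR lnK ?posrE // ltW.
rewrite [leLHS](E_stopped (leqnn N)) EFinD -[leRHS]addeA leeD //.
  apply: (@le_trans _ _ (\int[P]_w (c N)%:E)).
    apply: ge0_le_integral => //.
    - by move=> w _; rewrite lee_fin killed_ge0.
    - by apply/measurable_EFinP; exact: measurable_killed.
    - by move=> w _; rewrite lee_fin killed_le.
  by rewrite integral_cst //= probability_setT mule1.
apply: (@le_trans _ _ (\int[P]_w ((r * q)%:E * (crossing_sum N w)%:E +
    (\sum_(k < N) H k w)%:E))).
  apply: ge0_le_integral => //.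
  - by move=> w _; rewrite lee_fin sumr_ge0.
  - by apply/measurable_EFinP; exact: measurable_sum.
  - apply: emeasurable_funD; apply/measurable_EFinP.
      by apply: measurable_funM => //; exact: measurable_crossing_sum.
    exact: measurable_sum.
  - move=> w _; rewrite -EFinM -EFinD lee_fin /crossing_sum mulr_sumr -big_split.
    exact: ler_sum.
have rq : (0 <= r * q)%R by rewrite mulr_ge0 // ltW.
rewrite ge0_integralD //; first last.
- by apply/measurable_EFinP; exact: measurable_sum.
- by move=> w _; rewrite lee_fin sumr_ge0.
- apply/measurable_EFinP; apply: measurable_funM => //; exact: measurable_crossing_sum.
- by move=> w _; rewrite -EFinM lee_fin mulr_ge0 // crossing_sum_ge0.
rewrite addeC ge0_integralZl_EFin //; first last.
- by apply/measurable_EFinP; exact: measurable_crossing_sum.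
- by move=> w _; rewrite lee_fin crossing_sum_ge0.
apply: leeD => //.
under eq_integral do rewrite -sumEFin.
rewrite ge0_integral_sum //; last 2 first.
- by move=> k; apply/measurable_EFinP.
- by move=> k w _; rewrite lee_fin.
set e := expR _.
rewrite (_ : (N%:R * e)%:E = \sum_(k < N) e%:E); last first.
  by rewrite sumEFin sumr_const card_ord mulr_natl.
apply: lee_sum => k _; rewrite E_mul //.
rewrite -[leRHS]mul1e; set e' := expR _.
have -> : e' = e by rewrite /e /e'; congr expR; field.
by rewrite lee_wpmul2r ?lee_fin ?expR_ge0 // E_killed_le1 // ltnW.
Qed.

End killed_walk.

(** * First passage of Brownian motion with drift *)

Section brownian_first_passage.
Context (R : realType) (d : measure_display) (Omega : measurableType d)
  (P : probability Omega R) (W : R -> {RV P >-> R}).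
Hypothesis W_brownian : standard_brownian_motion W.

Lemma brownian_increment_mgf (t h s : R) : 0 <= t -> 0 < h ->
  (\int[P]_w (expR (s * (W (t + h) w - W t w)))%:E = (expR (s ^+ 2 * h / 2))%:E)%E.
Proof.
move=> t0 h0.
(* [normal_prob] is a measure on [measurableTypeR R]: integrals over that type
   and over [R] are not convertible, although the measurable sets are. *)
have mD : measurable_fun setT ((W (t + h) \- W t) : Omega -> measurableTypeR R).
  have mD0 : measurable_fun setT (W (t + h) \- W t) by exact: measurable_funB.
  by move=> mT Y mY; exact: (mD0 mT Y mY).
pose D : {mfun Omega >-> measurableTypeR R} :=
  HB.pack ((W (t + h) \- W t) : Omega -> measurableTypeR R)
    (isMeasurableFun.Build _ _ _ _ _ mD).
have mf : measurable_fun setT (fun x : measurableTypeR R => (expR (s * x))%:E).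
  by apply/measurable_EFinP; apply: measurableT_comp => //; exact: measurable_funM.
have := @ge0_integral_distribution _ _ _ _ _ P D (fun x => (expR (s * x))%:E) mf.
move=> /(_ (fun y => expR_ge0 _)) /= <-.
transitivity (\int[normal_prob 0 (Num.sqrt h)]_y (expR (s * y))%:E)%E.
  apply: eq_measure_integral => A mA _.
  have tth : t < t + h by rewrite ltrDl.
  have := sbm_gauss W_brownian t0 tth mA.
  by rewrite (_ : t + h - t = h) // addrC addKr.
by rewrite normal_prob_mgf ?sqrtr_gt0 // sqr_sqrtr // ltW.
Qed.

Variables (x nu sigma : R).
Hypotheses (x_gt0 : 0 < x) (nu_gt0 : 0 < nu) (sigma_gt0 : 0 < sigma).

(** Subtracting [W 0 w] makes every path start at exactly 0, whereas [W 0] vanishes only almost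
    surely. *)
Definition drifted (t : R) (w : Omega) : R := nu * t + sigma * (W t w - W 0 w).

Section grid.
Variables (al h : R).
Hypotheses (al_gt0 : 0 < al) (h_gt0 : 0 < h).

Let lam : R := al * nu + al ^+ 2 * sigma ^+ 2 / 2.
Let th : R := al * sigma.

Definition increment (k : nat) : {RV P >-> R} := W (k.+1%:R * h) \- W (k%:R * h).
(** The value of exp(al X_t - lam t) at t = k h when X_t = x. *)
Definition barrier (k : nat) : R := expR (al * x - lam * (k%:R * h)).

Local Notation killed := (killed increment th h barrier).
Local Notation crossing := (crossing increment th h barrier).
Local Notation crossing_sum := (crossing_sum increment th h barrier).
Local Notation wald := (wald increment th h).

Let expo k w := expR (al * drifted (k%:R * h) w - lam * (k%:R * h)).

Let expoS k w : expo k w * wald k w = expo k.+1 w.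
Proof.
rewrite /expo /wald -expRD; congr expR.
rewrite /increment /drifted /lam /th /= -natr1; by field.
Qed.

Let barrier_lt k w : (barrier k < expo k w) = (x < drifted (k%:R * h) w).
Proof. by rewrite /barrier /expo ltr_expR ltrD2r ltr_pM2l. Qed.

Lemma crossing_sumP N w :
  ((forall i, (i <= N)%N -> drifted (i%:R * h) w <= x) /\ crossing_sum N w = 0) \/
  (exists k, [/\ (k < N)%N, forall i, (i <= k)%N -> drifted (i%:R * h) w <= x,
     x < drifted (k.+1%:R * h) w & crossing_sum N w = barrier k.+1]).
Proof.
(* The induction also needs the value of [killed]: the exponential martingale before the crossing, 0
   after it. *)
suff: ([/\ forall i, (i <= N)%N -> drifted (i%:R * h) w <= x,
    killed N w = expo N w & crossing_sum N w = 0]) \/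
  (exists k, [/\ (k < N)%N, forall i, (i <= k)%N -> drifted (i%:R * h) w <= x,
     x < drifted (k.+1%:R * h) w, killed N w = 0 & crossing_sum N w = barrier k.+1]).
  by move=> [[? ? ?]|[k [? ? ? ? ?]]]; [left|right; exists k].
have b0 k : 0 < barrier k := expR_gt0 _.
elim: N => [|N [[alive kN SN]|[k [kN alive cross kN0 SN]]]].
- left; split.
  + move=> i; rewrite leqn0 => /eqP ->.
    by rewrite /drifted mul0r mulr0 subrr mulr0 addr0 ltW.
  + by rewrite /expo /drifted mul0r !mulr0 subrr !mulr0 addr0 mulr0 subrr expR0.
  + by rewrite /crossing_sum big_ord0.
- have SE : crossing_sum N.+1 w = barrier N.+1 * (barrier N.+1 < expo N.+1 w)%R%:R.
    move: SN; rewrite /crossing_sum big_ord_recr /= => ->.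
    by rewrite add0r /crossing kN expoS.
  have KE : killed N.+1 w = if expo N.+1 w <= barrier N.+1 then expo N.+1 w else 0.
    by rewrite /= kN expoS.
  case: (lerP (expo N.+1 w) (barrier N.+1)) => H.
    left; split.
    + move=> i; rewrite leq_eqVlt => /predU1P[->|]; last exact: alive.
      by rewrite leNgt -barrier_lt -leNgt.
    + by rewrite KE H.
    + by rewrite SE ltNge H mulr0.
  right; exists N; split => //.
  + by rewrite -barrier_lt.
  + by rewrite KE leNgt H.
  + by rewrite SE H mulr1.
- right; exists k; split => //.
  + exact: ltnW.
  + by rewrite /= kN0 mul0r ltW.
  + move: SN; rewrite /crossing_sum big_ord_recr /= => ->.
    by rewrite /crossing kN0 mul0r ltNge ltW // mulr0 addr0.
Qed.

End grid.

Definition grid_passage (m k : nat) (w : Omega) : \bar R :=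
  if x < drifted (k%:R * m.+1%:R^-1) w then (k%:R * m.+1%:R^-1)%:E else +oo%E.

(** Only the countably many times k / (m+1) enter, which makes measurability immediate; [passageE]
    recovers the infimum over all times on continuous paths. *)
Definition passage (w : Omega) : \bar R :=
  einfs (fun m => einfs (fun k => grid_passage m k w) 0) 0.

Lemma measurable_drifted t : measurable_fun setT (drifted t).
Proof.
apply: measurable_funD => //; apply: measurable_funM => //; exact: measurable_funB.
Qed.

Lemma measurable_passage : measurable_fun setT passage.
Proof.
apply: measurable_fun_einfs => m; apply: measurable_fun_einfs => k.
apply: measurable_fun_ifT => //; apply: measurable_fun_ltr => //.
exact: measurable_drifted.
Qed.

Lemma passage_le m k w : x < drifted (k%:R * m.+1%:R^-1) w ->
  (passage w <= (k%:R * m.+1%:R^-1)%:E)%E.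
Proof.
move=> xd; apply: ge_ereal_inf; exists (einfs (fun k => grid_passage m k w) 0).
  by exists m.
apply: ge_ereal_inf; exists (grid_passage m k w); first by exists k.
by rewrite /grid_passage xd.
Qed.

Lemma passage_lt w y : (passage w < y)%E -> exists m k,
  x < drifted (k%:R * m.+1%:R^-1) w /\ ((k%:R * m.+1%:R^-1)%:E < y)%E.
Proof.
move=> /ereal_inf_lt[_ [m _ <-]] /ereal_inf_lt[_ [k _ <-]].
rewrite /grid_passage; case: ifPn => [xd ky|_]; first by exists m, k.
by rewrite ltNge leey.
Qed.

Lemma passage_ge0 w : (0 <= passage w)%E.
Proof.
rewrite leNgt; apply/negP => /passage_lt[m [k [_]]].
by rewrite lte_fin ltNge mulr_ge0.
Qed.

Lemma grid_point (s0 del : R) (m : nat) : 0 <= s0 -> m.+1%:R^-1 < del ->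
  exists j : nat, s0 <= j%:R * m.+1%:R^-1 < s0 + del.
Proof.
move=> s00 mdel; exists (Num.truncn (s0 * m.+1%:R)).+1.
have m0 : 0 < m.+1%:R :> R by rewrite ltr0n.
apply/andP; split; first by rewrite ler_pdivlMr // ltW // truncnS_gt.
apply: le_lt_trans (_ : s0 + m.+1%:R^-1 < _); last by rewrite ltrD2l.
rewrite -natr1 mulrDl mul1r lerD2r ler_pdivrMr // truncn_le //.
by rewrite mulr_ge0 // ltW.
Qed.

Section continuous_path.
Variable w : Omega.
Hypothesis Wc : {within `[0, +oo[, continuous (fun t : R => W t w)}.

(** Continuity is known only within [0, +oo[, so the neighbourhood is taken on the right. *)
Lemma drifted_right_open (s0 : R) : 0 <= s0 -> x < drifted s0 w ->
  exists2 del, 0 < del & forall s, s0 <= s < s0 + del -> x < drifted s w.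
Proof.
move=> s00 xs.
have cd : drifted ^~ w @ within `[0, +oo[ (nbhs s0) --> drifted s0 w.
  apply: cvgD.
    by apply: cvgMl_tmp; apply: cvg_within_filter; exact: cvg_id.
  apply: cvgMl_tmp; apply: cvgB; last exact: cvg_cst.
  by have /subspace_continuousP := Wc; apply; rewrite /= in_itv /= s00.
have e0 : 0 < drifted s0 w - x by rewrite subr_gt0.
move/cvgrPdist_lt: cd => /(_ _ e0) [del /= del0 H].
exists del => // s /andP[s0s ssd].
have : `|drifted s0 w - drifted s w| < drifted s0 w - x.
  apply: H => /=; last by rewrite in_itv /= (le_trans s00).
  by rewrite distrC ger0_norm ?subr_ge0 // ltrBlDl.
by rewrite ltr_norml => /andP[_]; lra.
Qed.

Lemma passageE :
  passage w = ereal_inf [set t%:E | t in [set t | 0 <= t /\ x < drifted t w]].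
Proof.
apply/eqP; rewrite eq_le; apply/andP; split.
  apply: le_ereal_inf_tmp => _ [t [t0 xt] <-].
  have [del del0 H] := drifted_right_open t0 xt.
  apply/lee_addgt0Pr => e e0.
  (* A mesh below [del] puts a grid time where the path is still above [x]; a mesh below [e] keeps
     it close to [t]. *)
  have me0 : 0 < Num.min del e by rewrite lt_min del0.
  have [m mm] : exists m : nat, m.+1%:R^-1 < Num.min del e.
    exists (Num.truncn (Num.min del e)^-1).
    by rewrite -[ltRHS]invrK ltf_pV2 ?posrE ?invr_gt0 ?ltr0n // truncnS_gt.
  have [j /andP[tj jt]] := grid_point t0 mm.
  have xj : x < drifted (j%:R / m.+1%:R) w.
    by apply: H; rewrite tj /= (lt_le_trans jt) // lerD2l ge_min lexx.
  apply: (le_trans (passage_le xj)).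
  by rewrite -EFinD lee_fin ltW // (lt_le_trans jt) // lerD2l ge_min lexx orbT.
rewrite leNgt; apply/negP => /passage_lt[m [k [xd]]]; apply/negP; rewrite -leNgt.
by apply: ereal_inf_lbound; exists (k%:R * m.+1%:R^-1).
Qed.

End continuous_path.

End brownian_first_passage.

(** * Laplace transform of the passage time, as a limit over grids *)

Section passage_laplace.
Context (R : realType) (d : measure_display) (Omega : measurableType d)
  (P : probability Omega R) (W : R -> {RV P >-> R}).
Hypothesis W_brownian : standard_brownian_motion W.
Variables (x nu sigma al : R).
Hypotheses (x_gt0 : 0 < x) (nu_gt0 : 0 < nu) (sigma_gt0 : 0 < sigma)
  (al_gt0 : 0 < al).

Local Notation lam := (al * nu + al ^+ 2 * sigma ^+ 2 / 2).
Local Notation X := (drifted W nu sigma).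
Local Notation T := (passage W x nu sigma).
Local Notation step m := (m.+1%:R^-1 : R).
Local Notation cs m := (crossing_sum (increment W (step m)) (al * sigma)
  (step m) (barrier x nu sigma al (step m)) (m.+1 ^ 2)).

(** The explicit test is needed because [fine] sends +oo to 0, which would give 1 instead of 0. *)
Definition passage_exp (l : R) (w : Omega) : R :=
  if (T w < +oo)%E then expR (- l * fine (T w)) else 0.

Let lam_gt0 : 0 < lam.
Proof. by rewrite addr_gt0 ?mulr_gt0 ?exprn_gt0. Qed.

Let step_gt0 m : 0 < step m.
Proof. by rewrite invr_gt0 ltr0n. Qed.

Lemma passage_exp_ge0 l w : 0 <= passage_exp l w.
Proof. by rewrite /passage_exp; case: ifP => // _; exact: expR_ge0. Qed.

(** A crossing seen on the grid is no earlier than the passage time, and the barrier decreases in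
    time. *)
Lemma crossing_sum_le m w : cs m w <= expR (al * x) * passage_exp lam w.
Proof.
have e0 : 0 <= expR (al * x) * passage_exp lam w.
  by rewrite mulr_ge0 ?expR_ge0 ?passage_exp_ge0.
have [[_ ->] //|[k [_ _ xk ->]]] :=
  crossing_sumP W nu sigma x_gt0 (step m) al_gt0 (m.+1 ^ 2) w.
have Tk := passage_le xk.
have Tfin : (T w < +oo)%E by rewrite (le_lt_trans Tk) // ltry.
rewrite /passage_exp Tfin /barrier -expRD ler_expR lerD2l mulNr lerN2.
apply: ler_wpM2l; first exact: ltW.
by rewrite -lee_fin fineK // ge0_fin_numE // passage_ge0.
Qed.

Lemma crossing_sum_ge (e : R) w :
  {within `[0, +oo[, continuous (fun t : R => W t w)} -> 0 < e ->
  \forall m \near \oo,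
    expR (al * x) * passage_exp lam w * expR (- lam * e) <= cs m w.
Proof.
move=> Wc e0.
have cs0 m : 0 <= cs m w by apply: crossing_sum_ge0 => k; exact: expR_gt0.
rewrite /passage_exp; case: ifPn => [Tfin|_]; last by near=> m; rewrite mulr0 mul0r.
have Tf : T w \is a fin_num by rewrite ge0_fin_numE // passage_ge0.
have : (T w < (fine (T w) + e)%:E)%E by rewrite EFinD fineK // lteDl // lte_fin.
(* The path is above [x] at a time [s0] before T + e and, by continuity, just after it; every fine
   enough grid has a point there, within the horizon m + 1. *)
move=> /passage_lt[m0 [k0 [xs0]]]; rewrite lte_fin; set s0 := _ * _ => s0T.
have s00 : 0 <= s0 by rewrite /s0 mulr_ge0.
have [del del0 H] := drifted_right_open Wc s00 xs0.
have del'0 : 0 < Num.min del (fine (T w) + e - s0) by rewrite lt_min del0 subr_gt0.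
near=> m.
have mdel : step m < Num.min del (fine (T w) + e - s0).
  by near: m; exact: near_infty_natSinv_lt (PosNum del'0).
have [j /andP[s0j js]] := grid_point s00 mdel.
have xj : x < X (j%:R / m.+1%:R) w.
  by apply: H; rewrite s0j /= (lt_le_trans js) // lerD2l ge_min lexx.
have jT : j%:R / m.+1%:R < fine (T w) + e.
  by rewrite (lt_le_trans js) // -lerBrDl ge_min lexx orbT.
have m1 : 0 < m.+1%:R :> R by rewrite ltr0n.
have jN : (j <= m.+1 ^ 2)%N.
  rewrite -(ler_nat R) natrX expr2 -ler_pdivrMr // (le_trans (ltW jT)) //.
  rewrite -natr1 (@le_trans _ _ m%:R) ?lerDl //.
  by near: m; exact: nbhs_infty_ger.
have [[alive _]|[k [kN alive _ ->]]] :=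
  crossing_sumP W nu sigma x_gt0 (step m) al_gt0 (m.+1 ^ 2) w.
  by have := alive j jN; rewrite leNgt xj.
have kj : (k < j)%N by rewrite ltnNge; apply/negP => /alive; rewrite leNgt xj.
rewrite /barrier -!expRD ler_expR -addrA lerD2l !mulNr -opprD lerN2 -mulrDr.
apply: ler_wpM2l; first exact: ltW.
apply: le_trans (ltW jT); apply: ler_wpM2r; first exact: ltW.
by rewrite ler_nat.
Unshelve. all: by end_near. Qed.

Lemma crossing_sum_cvg w :
  {within `[0, +oo[, continuous (fun t : R => W t w)} ->
  cs m w @[m --> \oo] --> expR (al * x) * passage_exp lam w.
Proof.
move=> Wc; set L := expR (al * x) * _.
have L0 : 0 <= L.
  by rewrite mulr_ge0 ?expR_ge0 ?passage_exp_ge0.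
(* With time error e / c the gap is at most L lam e / c = e L / (L + 1) <= e; [L + 1] avoids
   dividing by a possibly zero [L]. *)
apply/cvgrPdist_le => e e0; pose c := (L + 1) * lam.
have L1 : 0 < L + 1 by rewrite ltr_wpDl.
have c0 : 0 < c by exact: mulr_gt0.
have ec0 : 0 < e / c by rewrite divr_gt0.
near=> m.
have H : L * expR (- lam * (e / c)) <= cs m w.
  by near: m; exact: crossing_sum_ge.
have h1 : 0 <= L - cs m w by rewrite subr_ge0 crossing_sum_le.
rewrite ger0_norm // lerBlDr -lerBlDl; apply: le_trans H.
apply: le_trans (ler_wpM2l L0 (expR_ge1Dx _)).
rewrite mulrDr mulr1 lerD2l mulNr mulrN lerN2.
rewrite (_ : L * (lam * (e / c)) = (L / (L + 1)) * e).
  apply: ler_piMl; first exact: ltW.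
  by rewrite ler_pdivrMr // mul1r lerDl.
have {}L1 := lt0r_neq0 L1; have l0 := lt0r_neq0 lam_gt0.
have gen (l a b f : R) : l != 0 -> a != 0 -> b * (l * (f / (a * l))) = b / a * f.
  by move=> ln0 an0; field; rewrite ln0 an0.
exact: gen.
Unshelve. all: by end_near. Qed.

Lemma measurable_fine_passage : measurable_fun setT (fun w => fine (T w)).
Proof.
exact: (measurableT_comp (fine_measurable _) (measurable_passage W x nu sigma)).
Qed.

Lemma measurable_passage_lty : measurable [set w | (T w < +oo)%E].
Proof.
have -> : [set w | (T w < +oo)%E] = T @^-1` (~` [set +oo%E]).
  by apply/seteqP; split => w /=; rewrite ltey => /eqP.
rewrite -[X in measurable X]setTI; apply: measurable_passage => //.
exact: measurableC.
Qed.

Lemma measurable_passage_exp l : measurable_fun setT (passage_exp l).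
Proof.
apply: measurable_fun_ifT => //.
  apply: (measurable_fun_bool true); rewrite setTI.
  rewrite (_ : _ @^-1` _ = [set w | (T w < +oo)%E]); first exact: measurable_passage_lty.
  by apply/seteqP; split => w.
apply: measurableT_comp => //; apply: measurable_funM => //.
exact: measurable_fine_passage.
Qed.

Lemma barrier0_ge1 h : 1 <= barrier x nu sigma al h 0.
Proof. by rewrite /barrier mul0r mulr0 subr0 -expR0 ler_expR ltW // mulr_gt0. Qed.

Lemma increment_independent h N : 0 < h ->
  mutually_independent P (fun i : 'I_N => increment W h i).
Proof.
move=> h0; have mono : {homo (fun i : nat => i%:R * h) : i j / (i <= j)%N >-> i <= j}.
  by move=> i j ij; rewrite ler_wpM2r ?ler_nat // ltW.
by apply: (sbm_indep W_brownian) mono; rewrite mul0r.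
Qed.

Lemma increment_mgf h k (s : R) : 0 < h ->
  (\int[P]_w (expR (s * increment W h k w))%:E = (expR (s ^+ 2 * h / 2))%:E)%E.
Proof.
move=> h0; rewrite /increment -natr1 mulrDl mul1r.
by apply: (brownian_increment_mgf W_brownian) => //; rewrite mulr_ge0 // ltW.
Qed.

Lemma integral_crossing_sum_ub m : (\int[P]_w (cs m w)%:E <= 1)%E.
Proof.
apply: integral_crossing_sum_le1 => [k||k s _].
- exact: expR_gt0.
- exact: increment_independent.
- exact: increment_mgf.
Qed.

(** With r = exp(rho) and p = rho / (th^2 h), the exponent in [integral_crossing_sum_ge] becomes rho
    / 2 - ka (m+1), whose decay beats the (m+1)^2 summands. *)
Lemma integral_crossing_sum_lb (rho : R) : 0 < rho -> exists K : R, forall m,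
  (1 <= (K * step m)%:E + (expR rho * expR (lam * step m))%:E *
    \int[P]_w (cs m w)%:E)%E.
Proof.
move=> rho0; pose th := al * sigma; pose ka := rho ^+ 2 / (2 * th ^+ 2).
have th0 : 0 < th by rewrite mulr_gt0.
have ka0 : 0 < ka by rewrite divr_gt0 ?exprn_gt0 // mulr_gt0 // exprn_gt0.
(* The first summand bounds the mass alive at time m + 1, the second the large increments:
   [expr_expRN_le] with exponents 1 and 3 leaves one factor 1 / (m+1) in each. *)
exists (expR (al * x) * (1`!%:R / lam ^+ 1) + expR (rho / 2) * (3`!%:R / ka ^+ 3)) => m.
have m0 : 0 < m.+1%:R :> R by rewrite ltr0n.
have n0 := lt0r_neq0 m0.
have := @integral_crossing_sum_ge _ _ _ P (increment W (step m)) th (step m)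
  (barrier x nu sigma al (step m)).
move=> /(_ _ (fun k => expR_gt0 _) (m.+1 ^ 2)%N).
move=> /(_ _ _ _ (expR (lam * step m)) (expR rho) (rho / (th ^+ 2 * step m))).
rewrite expRK => H; apply: le_trans (H _ _ _ _ _ _) _.
- exact: barrier0_ge1.
- exact: increment_independent.
- by move=> k s _; exact: increment_mgf.
- exact: expR_gt0.
- by rewrite divr_ge0 ?ltW // mulr_gt0 // exprn_gt0.
- move=> k; rewrite /barrier -expRD ler_expR -natr1.
  by rewrite le_eqVlt; apply/orP; left; apply/eqP; ring.
apply: leeD => //; rewrite lee_fin mulrDl; apply: lerD.
  rewrite /barrier expRD -[leRHS]mulrA ler_wpM2l ?expR_ge0 // ler_pdivlMr //.
  rewrite (_ : (m.+1 ^ 2)%:R * step m = m.+1%:R); last by rewrite natrX expr2 mulfK.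
  by rewrite mulrC -mulNr; apply: (expr_expRN_le 1) => //; exact: ltW.
rewrite (_ : _ * _ / 2 - _ * rho = rho / 2 + (- ka * m.+1%:R)); last first.
  have thn := lt0r_neq0 th0.
  by rewrite /ka; field; rewrite thn addrC natr1 n0.
rewrite expRD mulrCA -[leRHS]mulrA ler_wpM2l ?expR_ge0 // ler_pdivlMr //.
rewrite natrX mulrAC -exprSr.
by apply: expr_expRN_le => //; exact: ltW.
Qed.

Lemma integral_passage_exp :
  (\int[P]_w (passage_exp lam w)%:E = (expR (- al * x))%:E)%E.
Proof.
have cs0 m w : 0 <= cs m w by apply: crossing_sum_ge0 => k; exact: expR_gt0.
have passage_exp_le1 w : passage_exp lam w <= 1.
  rewrite /passage_exp; case: ifP => // _; rewrite -[leRHS]expR0 ler_expR.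
  by rewrite mulNr oppr_le0 mulr_ge0 ?fine_ge0 ?passage_ge0 // ltW.
have cs_le m w : cs m w <= expR (al * x).
  apply: le_trans (crossing_sum_le m w) _.
  by rewrite ler_piMr ?expR_ge0.
have mcs m : measurable_fun setT (fun w => (cs m w)%:E).
  by apply/measurable_EFinP; exact: measurable_crossing_sum.
have mp : measurable_fun setT (fun w => (expR (al * x) * passage_exp lam w)%:E).
  apply/measurable_EFinP; apply: measurable_funM => //.
  exact: measurable_passage_exp.
have cvg_ae : {ae P, forall w, setT w ->
    (cs m w)%:E @[m --> \oo] --> (expR (al * x) * passage_exp lam w)%:E}.
  apply: filterS (sbm_cont W_brownian) => w Wc _.
  apply/cvg_EFin; first by near=> m.
  exact: crossing_sum_cvg.
have iK : P.-integrable setT (EFin \o cst (expR (al * x))).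
  exact: finite_measure_integrable_cst.
have dom : {ae P, forall w m, setT w ->
    (`|(cs m w)%:E| <= (EFin \o cst (expR (al * x))) w)%E}.
  apply: aeW => w m _; rewrite lee_fin ger0_norm //.
have [ip _ cvgI] := dominated_convergence measurableT mcs mp cvg_ae iK dom.
set L := (\int[P]_w _)%E in cvgI *.
have LE : (\int[P]_w (expR (al * x) * passage_exp lam w)%:E = (expR (al * x))%:E * L)%E.
  under eq_integral do rewrite EFinM.
  rewrite ge0_integralZl_EFin ?expR_ge0 //.
  - by move=> w _; rewrite lee_fin passage_exp_ge0.
  - by apply/measurable_EFinP; exact: measurable_passage_exp.
have I_ge0 m : (0 <= \int[P]_w (cs m w)%:E)%E.
  by apply: integral_ge0 => w _; rewrite lee_fin.
have I_le1 m : (\int[P]_w (cs m w)%:E <= 1)%E.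
  exact: (integral_crossing_sum_ub _).
pose I m := fine (\int[P]_w (cs m w)%:E)%E.
have IE m : (\int[P]_w (cs m w)%:E = (I m)%:E)%E.
  by rewrite /I fineK // ge0_fin_numE // (le_lt_trans (I_le1 m)) // ltry.
have [ell ellE] : exists ell : R,
    (\int[P]_w (expR (al * x) * passage_exp lam w)%:E)%E = ell%:E.
  exists (fine (\int[P]_w (expR (al * x) * passage_exp lam w)%:E)%E).
  by rewrite fineK // integrable_fin_num.
have cvgI' : I m @[m --> \oo] --> ell.
  by move: cvgI; rewrite ellE => /fine_cvg.
have ell_le1 : ell <= 1.
  rewrite -(cvg_lim _ cvgI') //; apply: limr_le; first by apply/cvg_ex; exists ell.
  by near=> m; rewrite -lee_fin -IE.
have ell_ge1 : 1 <= ell.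
  (* The mesh tends to 0 with [rho] fixed; only afterwards does [rho] tend to 0. *)
  have ge rho : 0 < rho -> 1 <= expR rho * ell.
    move=> rho0.
    have [K HK] := integral_crossing_sum_lb rho0.
    have cv : K * step m + expR rho * expR (lam * step m) * I m @[m --> \oo] -->
        K * 0 + expR rho * expR (lam * 0) * ell.
      apply: cvgD; first by apply: cvgMl_tmp; exact: cvg_harmonic.
      apply: cvgM => //; apply: cvgMl_tmp.
      apply: continuous_cvg; first exact: continuous_expR.
      by apply: cvgMl_tmp; exact: cvg_harmonic.
    rewrite mulr0 add0r mulr0 expR0 mulr1 in cv.
    rewrite -(cvg_lim _ cv) //; apply: limr_ge; first by apply/cvg_ex; eexists; exact: cv.
    by near=> m; have := HK m; rewrite IE -EFinM -EFinD lee_fin.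
  apply/ler_addgt0Pr => e e0; rewrite -lerBlDr.
  apply: (le_trans (expR_ge1Dx (- e))).
  by rewrite expRN -[_^-1]mulr1 ler_pdivrMl ?expR_gt0 // ge.
have : ((expR (al * x))%:E * L = 1)%E.
  by rewrite -LE ellE; congr EFin; apply/eqP; rewrite eq_le ell_le1.
have Lfin : L \is a fin_num.
  rewrite ge0_fin_numE; last by apply: integral_ge0 => w _; rewrite lee_fin passage_exp_ge0.
  apply: (@le_lt_trans _ _ (\int[P]_w 1)%E); last first.
    by rewrite integral_cst //= probability_setT mule1 ltry.
  apply: ge0_le_integral => //.
  - by move=> w _; rewrite lee_fin passage_exp_ge0.
  - by apply/measurable_EFinP; exact: measurable_passage_exp.
  - by move=> w _; rewrite lee_fin.
rewrite -(fineK Lfin) -EFinM => -[eL1]; congr EFin.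
by apply: (mulfI (lt0r_neq0 (expR_gt0 (al * x)))); rewrite eL1 -expRD mulNr subrr expR0.
Unshelve. all: by end_near. Qed.

End passage_laplace.

(* The integral of a nonnegative function is a supremum over simple functions,
   so [f] need not be measurable: the null set where the Brownian paths are
   irregular may contain non-measurable sets. *)
Lemma ge0_ae_eq_integral_nonmeasurable (R : realType) (d : measure_display)
    (T : measurableType d) (mu : {measure set T -> \bar R}) (f g : T -> \bar R) :
  measurable_fun setT g -> (forall w, 0 <= f w)%E -> (forall w, 0 <= g w)%E ->
  {ae mu, forall w, f w = g w} -> (\int[mu]_w f w = \int[mu]_w g w)%E.
Proof.
move=> mg f0 g0 [N [mN N0 fgN]].
have fg w : w \notin N -> f w = g w.
  by move=> /negP wN; apply: contrapT => fgw; apply: wN; rewrite inE; exact: fgN.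
have mono (f1 f2 : T -> \bar R) : (forall w, 0 <= f1 w)%E ->
    (forall w, f1 w <= f2 w)%E ->
    (\int[mu]_w f1 w <= \int[mu]_w f2 w)%E.
  move=> f10 f12; rewrite !ge0_integralTE // => [|w]; last exact: le_trans (f12 w).
  apply: le_ereal_sup => _ [h hf <-]; exists h => // w; exact: le_trans (f12 w).
(* Replacing [g] on the null set by 0 and by +oo gives two measurable functions that bracket [f] and
   have the integral of [g]. *)
have mif c : measurable_fun setT (fun w => if w \in N then c else g w).
  apply: measurable_fun_ifT => //; apply: (measurable_fun_bool true).
  rewrite setTI (_ : _ @^-1` _ = N) //.
  by apply/seteqP; split => w; [exact: set_mem|exact: mem_set].
have intE c : (0 <= c)%E ->
    (\int[mu]_w (if w \in N then c else g w) = \int[mu]_w g w)%E.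
  move=> c0; apply: ge0_ae_eq_integral => //; first by move=> w _; case: ifP.
  exists N; split => // w /= H; apply: contrapT => wN; apply: H => _.
  by rewrite ifF //; apply/negbTE; rewrite notin_setE.
apply/eqP; rewrite eq_le; apply/andP; split.
  rewrite -(intE +oo%E) ?leey //; apply: mono => // w.
  by case: ifPn => [_|/fg ->]; rewrite ?leey.
rewrite -(intE 0%E) //; apply: mono => w; first by case: ifP.
by case: ifPn => [_|/fg ->].
Qed.

(** * Moments of the passage time *)

Section passage_moments.
Context (R : realType) (d : measure_display) (Omega : measurableType d)
  (P : probability Omega R) (W : R -> {RV P >-> R}).
Hypothesis W_brownian : standard_brownian_motion W.
Variables (x nu sigma : R).
Hypotheses (x_gt0 : 0 < x) (nu_gt0 : 0 < nu) (sigma_gt0 : 0 < sigma).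

Local Notation T := (passage W x nu sigma).
Local Notation A := [set w | (T w < +oo)%E].

Let q : R := 2 * sigma ^+ 2 / nu ^+ 2.
Let c : R := x * nu / sigma ^+ 2.

Lemma laplace_passage (l : R) : 0 < l ->
  \int[P]_(w in A) expR (- l * fine (T w)) =
  expR c * expR (- c * sqrt_derivative q 0 l).
Proof.
move=> l0; set r := sqrt_derivative q 0 l.
have q0 : 0 < q by rewrite divr_gt0 ?exprn_gt0 // mulr_gt0 // exprn_gt0.
have rE : r = Num.sqrt (1 + q * l).
  rewrite /r /sqrt_derivative /falling_factorial big_ord0 expr0 !mul1r subr0.
  by rewrite powR12_sqrt // addr_ge0 // mulr_ge0 // ltW.
have r2 : r ^+ 2 = 1 + q * l.
  by rewrite rE sqr_sqrtr // addr_ge0 // mulr_ge0 // ltW.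
have r1 : 1 < r.
  have ql : 0 < q * l by exact: mulr_gt0.
  by rewrite rE -[ltLHS]sqrtr1 ltr_sqrt ?ltrDl // addr_gt0.
(* The positive root of al nu + al^2 sigma^2 / 2 = l. *)
pose al := nu * (r - 1) / sigma ^+ 2.
have al0 : 0 < al by rewrite divr_gt0 ?exprn_gt0 // mulr_gt0 // subr_gt0.
have s0 := lt0r_neq0 sigma_gt0; have n0 := lt0r_neq0 nu_gt0.
have lamE : al * nu + al ^+ 2 * sigma ^+ 2 / 2 = l.
  transitivity (nu ^+ 2 * (r ^+ 2 - 1) / (2 * sigma ^+ 2)).
    by rewrite /al; field.
  by rewrite r2 /q; field; rewrite s0 n0.
have := integral_passage_exp W_brownian x_gt0 nu_gt0 sigma_gt0 al0.
rewrite lamE => H.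
rewrite -expRD (_ : c + - c * r = - al * x); last by rewrite /c /al; field.
rewrite -[RHS]/(fine (expR (- al * x))%:E) -H /Rintegral; congr fine.
rewrite integral_mkcond; apply: eq_integral => w _.
rewrite patchE /passage_exp; case: ifPn => [/set_mem /= -> //|/negP wA].
by rewrite ifF //; apply/negP => h; apply: wA; exact: mem_set.
Qed.

Lemma passage_moment n : (\int[P]_(w in A) (fine (T w) ^+ n)%:E =
  ((- q) ^+ n * bell_polynomial n (- c) (falling_factorial (1 / 2)))%:E)%E.
Proof.
have q0 : 0 < q by rewrite divr_gt0 ?exprn_gt0 // mulr_gt0 // exprn_gt0.
have mA : measurable A := measurable_passage_lty W x nu sigma.
have mT := measurable_fine_passage W x nu sigma.
have T0 w : 0 <= fine (T w) by rewrite fine_ge0 // passage_ge0.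
pose g := faa_di_bruno (- c) (expR (- - c)) (sqrt_derivative q).
have dg k (l : R) : 0 <= l -> is_derive l 1 (g k) (g k.+1 l).
  move=> l0; apply: is_derive_faa_di_bruno => j.
  by apply: is_derive_sqrt_derivative; rewrite ltr_pwDl // mulr_ge0 // ltW.
have gL (l : R) : 0 < l -> \int[P]_(w in A) expR (- l * fine (T w)) = g 0 l.
  by move=> l0; rewrite laplace_passage // /g /faa_di_bruno mulr1 opprK.
rewrite (laplace_moments mA mT T0 dg gL).
by rewrite /g faa_di_bruno_sqrt0 [in RHS]exprNn mulrA.
Qed.

(** The moment of order 0 is the probability of [A], and the formula gives it the value 1. *)
Lemma passage_finite : {ae P, forall w, (T w < +oo)%E}.
Proof.
have mA : measurable A := measurable_passage_lty W x nu sigma.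
have := passage_moment 0.
under eq_integral do rewrite expr0.
rewrite integral_cst // mul1e expr0 mul1r /= => PA.
exists (~` A); split; [exact: measurableC| |by []].
by rewrite probability_setC // PA subee.
Qed.

End passage_moments.

Theorem proposition2p1 (R : realType) (d : measure_display)
    (Omega : measurableType d) (P : probability Omega R)
    (W : R -> {RV P >-> R}) (mu sigma y0 S : R)
    (W_brownian : standard_brownian_motion W)
    (sigma_gt0 : 0 < sigma) (mu_gt : sigma ^+ 2 / 2 < mu)
    (y0_gt0 : 0 < y0) (y0_lt_S : y0 < S) (n : nat) (n_ge1 : (1 <= n)%N) :
  let Y := geometric_brownian_motion W mu sigma y0 in
  let T := first_passage_time Y S in
  let a := (ln S - ln y0) ^+ 2 / sigma ^+ 2 in
  let b := (ln S - ln y0) / (mu - sigma ^+ 2 / 2) in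
  (\int[P]_w (T w ^+ n))%E =
  ((- (2 * b ^+ 2 / a)) ^+ n *
   partition_polynomial n (- (a / b)) (falling_factorial (1 / 2)))%:E.
Proof.
move=> Y T a b.
have S_gt0 : 0 < S := lt_trans y0_gt0 y0_lt_S.
set x := ln S - ln y0 in a b *; set nu := mu - sigma ^+ 2 / 2 in b *.
have x_gt0 : 0 < x by rewrite subr_gt0 ltr_ln ?posrE.
have nu_gt0 : 0 < nu by rewrite subr_gt0.
have T_ge0 w : (0 <= T w)%E.
  by apply: le_ereal_inf_tmp => _ [t [t0 _] <-]; rewrite lee_fin.
pose T' := passage W x nu sigma.
have ->: (\int[P]_w (T w ^+ n) = \int[P]_w (fine (T' w) ^+ n)%:E)%E.
  apply: ge0_ae_eq_integral_nonmeasurable.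
  - apply/measurable_EFinP; apply: measurable_funX.
    exact: measurable_fine_passage.
  - by move=> w; exact: expe_ge0.
  - by move=> w; rewrite lee_fin exprn_ge0 // fine_ge0 // passage_ge0.
  - have fin := passage_finite W_brownian x_gt0 nu_gt0 sigma_gt0.
    apply: filterS3 fin (sbm_start W_brownian) (sbm_cont W_brownian) => w Tw W0 Wc.
    have TT' : T w = T' w.
      rewrite /T' (passageE _ _ _ Wc) /T /first_passage_time; congr ereal_inf.
      have cond t : (S < Y t w) = (x < drifted W nu sigma t w).
        rewrite /drifted W0 subr0 -[RHS]ltr_expR /x expRB !lnK ?posrE //.
        by rewrite ltr_pdivrMr // mulrC.
      apply/seteqP; split => _ [t [t0 St] <-]; exists t => //;
        by split; rewrite // ?cond // -cond.
    by rewrite TT' EFin_expe fineK // ge0_fin_numE // passage_ge0.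
have -> : (\int[P]_w (fine (T' w) ^+ n)%:E =
    \int[P]_(w in [set w | T' w < +oo]) (fine (T' w) ^+ n)%:E)%E.
  rewrite [RHS]integral_mkcond; apply: eq_integral => w _; rewrite patchE.
  case: ifPn => // /negP wA; have -> : T' w = +oo%E.
    by apply/eqP; rewrite -leye_eq leNgt; apply/negP => h; apply: wA; exact: mem_set.
  (* Off the event, [fine] gives 0, and 0^n = 0 because n >= 1. *)
  by rewrite /= expr0n; case: (n) n_ge1.
rewrite passage_moment //; congr EFin.
have s0 := lt0r_neq0 sigma_gt0; have n0 := lt0r_neq0 nu_gt0; have x0 := lt0r_neq0 x_gt0.
rewrite (_ : 2 * b ^+ 2 / a = 2 * sigma ^+ 2 / nu ^+ 2); last first.
  by rewrite /a /b; field; rewrite n0 x0 s0.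
rewrite (_ : a / b = x * nu / sigma ^+ 2); last first.
  by rewrite /a /b; field; rewrite n0 x0 s0.
by rewrite /bell_polynomial; case: (n) n_ge1.
Qed.
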